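(* Let $\mu$ be a permuton which admits a piecewise continuous and strictly positive density $f:[0,1]^2\to(0,\infty)$ that is continuous at $(0,0)$ and at $(1,1)$. For each $n\ge1$ let $\mathcal{I}_n^\mu$ be the minimal inversion of $n$ i.i.d. points distributed according to $\mu$. Then, as $n\to\infty$, $n^{-1/2}\mathcal{I}_n^\mu$ converges in distribution to the $\mathrm{Rayleigh}\left(2,\frac{f(0,0)+f(1,1)}{2}\right)$ distribution.
   Context: A permuton is a probability measure $\mu$ on $[0,1]^2$ with uniform marginals: $\mu([0,1]\times A)=\mu(A\times[0,1])=\lambda_1(A)$ for all measurable $A\subseteq[0,1]$, with $\lambda_1$ Lebesgue measure. Minimal inversion: for i.i.d. points $(X_1,Y_1),\ldots,(X_n,Y_n)$ sampled from $\mu$, let $\mathrm{Inv}(i)=\{j:(X_i-X_j)(Y_i-Y_j)<0\}$ and $\mathcal{I}_n^\mu=\min\{|\mathrm{Inv}(i)|:1\le i\le n\}$. $\mathrm{Rayleigh}(a,b)$ is the law of a random variable $R$ on $[0,\infty)$ with $\mathbb{P}(R>t)=e^{-bt^a}$ for all $t\ge0$. *)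

(* Defs.v *)
From HB Require Import structures.
From mathcomp Require Import all_boot all_order all_algebra.
From mathcomp Require Import all_classical all_reals all_analysis.
From mathcomp Require Import measurable_realfun.

Set Implicit Arguments.
Unset Strict Implicit.
Unset Printing Implicit Defensive.

Import Order.TTheory GRing.Theory Num.Def Num.Theory.
Import numFieldNormedType.Exports.

Local Open Scope classical_set_scope.
Local Open Scope ring_scope.

Section permutons.
Context {R : realType}.

Definition unit_square : set (R * R) := `[0, 1] `*` `[0, 1].

Local Notation lebesgue2 :=
  ((@lebesgue_measure R) \x (@lebesgue_measure R))%E.

(* Borel probability measures on [0, 1]^2 are represented as Borel probability
   measures on R^2 concentrated on [0, 1]^2. *)
Definition is_permuton (mu : probability (R * R)%type R) : Prop :=
  mu unit_square = 1%E /\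
  forall A : set R, measurable A -> A `<=` `[0, 1] ->
    mu (`[0, 1] `*` A) = lebesgue_measure A /\
    mu (A `*` `[0, 1]) = lebesgue_measure A.

(* A function on [0, 1]^2 is represented by a function on R^2, of which only
   the values on [0, 1]^2 are ever used. *)
Definition is_density (mu : probability (R * R)%type R) (f : R * R -> R) :
    Prop :=
  measurable_fun unit_square f /\
  forall A : set (R * R), measurable A -> A `<=` unit_square ->
    mu A = (\int[lebesgue2]_(p in A) (f p)%:E)%E.

(* [0, 1]^2 is partitioned into finitely many pieces with Lebesgue-null
   boundary, and f is continuous on the interior of each of them. *)
Definition piecewise_continuous (f : R * R -> R) : Prop :=
  exists (k : nat) (D : 'I_k -> set (R * R)),
    [/\ \bigcup_i D i = unit_square,
        trivIset [set: 'I_k] D,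
        forall i, lebesgue2 (closure (D i) `\` (D i)°) = 0%E &
        forall i p, (D i)° p -> {for p, continuous f}].

(* continuity at p of the restriction of f to [0, 1]^2 *)
Definition square_continuous_at (f : R * R -> R) (p : R * R) : Prop :=
  f x @[x --> within unit_square (nbhs p)] --> f p.

End permutons.

Section minimal_inversion.
Context {R : realType}.

Definition Inv n (z : 'I_n -> R * R) (i : 'I_n) : {set 'I_n} :=
  [set j | ((z i).1 - (z j).1) * ((z i).2 - (z j).2) < 0]%SET.

(* The default value n exceeds all cardinals #|Inv z i|, so that this is the
   actual minimum as soon as 0 < n. *)
Definition minimal_inversion n (z : 'I_n -> R * R) : nat :=
  \big[minn/n]_(i < n) #|Inv z i|.

End minimal_inversion.

Section random_variables.
Context {R : realType}.

Definition mutually_independent n d (Omega : measurableType d)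
    (P : probability Omega R) d' (T : measurableType d')
    (Z : 'I_n -> {RV P >-> T}) : Prop :=
  forall (J : {set 'I_n}) (A : 'I_n -> set T),
    (forall i, measurable (A i)) ->
    P (\bigcap_(i in [set` J]) (Z i @^-1` A i)) =
    (\prod_(i in J) P (Z i @^-1` A i))%E.

Definition iid n d (Omega : measurableType d) (P : probability Omega R)
    d' (T : measurableType d') (mu : probability T R)
    (Z : 'I_n -> {RV P >-> T}) : Prop :=
  mutually_independent Z /\
  forall i (A : set T), measurable A -> distribution P (Z i) A = mu A.

Definition converges_in_distribution (d : nat -> measure_display)
    (Omega : forall n, measurableType (d n))
    (P : forall n, probability (Omega n) R)
    (X : forall n, {RV (P n) >-> R}) (nu : probability R R) : Prop :=
  forall t : R, {for t, continuous (fun s : R => nu `]-oo, s]%classic)} ->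
    cdf (X n) t @[n --> \oo] --> nu `]-oo, t]%classic.

Definition is_rayleigh (a b : R) (nu : probability R R) : Prop :=
  nu `[0, +oo[%classic = 1%E /\
  forall t : R, 0 <= t -> nu `]t, +oo[%classic = (expR (- b * t `^ a))%:E.

Section scaled.
Context (n : nat) d (Omega : measurableType d) (P : probability Omega R).
Variable Z : 'I_n -> {RV P >-> (R * R)%type}.

Definition scaled_minimal_inversion : Omega -> R :=
  fun w => (Num.sqrt n%:R)^-1 * (minimal_inversion (Z ^~ w))%:R.

Let mInv i j : measurable_fun [set: Omega] (fun w => j \in Inv (Z ^~ w) i).
Proof.
have m1 k : measurable_fun [set: Omega] (fun w => (Z k w).1).
  by apply: (measurableT_comp measurable_fst).
have m2 k : measurable_fun [set: Omega] (fun w => (Z k w).2).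
  by apply: (measurableT_comp measurable_snd).
rewrite (_ : (fun w => _) = fun w =>
  (((Z i w).1 - (Z j w).1) * ((Z i w).2 - (Z j w).2) < 0)).
  apply: measurable_fun_ltr => //.
  by apply: measurable_funM; apply: measurable_funB.
by apply/funext => w; rewrite !inE.
Qed.

Let measurable_scaled :
  measurable_fun [set: Omega] scaled_minimal_inversion.
Proof.
apply: measurable_funM => //.
have mcard i : measurable_fun [set: Omega]
    (fun w => #|Inv (Z ^~ w) i|%:R : R).
  rewrite (_ : (fun w => _) =
      (fun w => \sum_(j < n) (if j \in Inv (Z ^~ w) i then 1 else 0 : R))).
    apply: measurable_sum => j.
    by apply: measurable_fun_ifT.
  by apply/funext => w; rewrite -sum1_card natr_sum big_mkcond.
rewrite (_ : (fun w => _) =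
    (fun w => \big[Num.min/n%:R]_(i < n) (#|Inv (Z ^~ w) i|%:R : R))).
  elim: (index_enum _) => [|i s IH].
    by under eq_fun do rewrite big_nil; exact: measurable_cst.
  under eq_fun do rewrite big_cons.
  exact: measurable_minr.
apply/funext => w.
apply: (big_morph (fun k : nat => k%:R : R)) => // x y.
by rewrite natr_min.
Qed.

HB.instance Definition _ := isMeasurableFun.Build _ _ _ _
  scaled_minimal_inversion measurable_scaled.

End scaled.

End random_variables.

(* There is a law satisfying is_rayleigh a b: that of E^(1/a), where E is
   exponential of rate b. *)
Lemma is_rayleigh_exists (R : realType) (a b : R) : 0 < a -> 0 < b ->
  exists nu : probability R R, is_rayleigh a b nu.
Proof.
move=> a0 b0.
have [mu muE] : exists mu : probability (measurableTypeR R) R,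
    forall A, mu A = exponential_prob b A.
  by exists (exponential_distribution_exponential_prob__canonical__probability_measure_Probability b0).
have mu_neg : mu `]-oo, 0[%classic = 0%E.
  rewrite muE /exponential_prob; apply: integral0_eq => x /=.
  by rewrite in_itv/= => x0; rewrite lt0_exponential_pdf.
have mu_0c (s : R) : 0 <= s -> mu `[0, s]%classic = (1 - (expR (- b * s))%:E)%E.
  rewrite le_eqVlt => /orP[/eqP <-|s0]; rewrite muE.
    rewrite mulr0 expR0 subee// /exponential_prob set_itv1.
    by rewrite integral_set1.
  exact: exponential_prob_itv0c.
have mu_tail (s : R) : 0 <= s -> mu `]s, +oo[%classic = (expR (- b * s))%:E.
  move=> s0.
  have -> : [set` `]s, +oo[] = ~` `]-oo, s] :> set R by rewrite setCitvl.
  rewrite probability_setC//.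
  have -> : [set` `]-oo, s]] = `]-oo, 0[ `|` `[0, s] :> set R.
    by rewrite -itv_bndbnd_setU// bnd_simp.
  rewrite measureU//; last first.
    apply/seteqP; split => x //= []; rewrite !in_itv/= => x0 /andP[].
    by rewrite leNgt x0.
  rewrite [X in (_ - (X + _))%E]mu_neg [X in (_ - (_ + X))%E]mu_0c//.
  by rewrite add0e oppeB// addeA subee// add0e.
pose g (x : R) : R := (Num.max 0 x) `^ a^-1.
have mg : measurable_fun [set: R] g.
  apply: (measurableT_comp (measurable_powR _)).
  exact: measurable_maxr.
pose Xmix := isMeasurableFun.Build _ _ (measurableTypeR R) R g mg.
pose X : {RV mu >-> R} := HB.pack g Xmix.
exists (distribution mu X); split.
  transitivity (mu setT); last exact: probability_setT.
  rewrite /distribution /pushforward; congr (mu _).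
  by apply/seteqP; split => // x _ /=; rewrite in_itv/= andbT powR_ge0.
move=> t t0; rewrite -mu_tail ?powR_ge0//.
rewrite /distribution /pushforward; congr (mu _).
have tK : (t `^ a) `^ a^-1 = t by rewrite -powRrM mulfV ?gt_eqF// powRr1.
have ai0 : 0 < a^-1 by rewrite invr_gt0.
apply/seteqP; split => x /=; rewrite !in_itv/= !andbT /g => tx.
  rewrite ltNge; apply/negP => xt; move: tx; rewrite ltNge => /negP; apply.
  rewrite -[leRHS]tK; apply: ge0_ler_powR; rewrite ?nnegrE ?powR_ge0 ?(ltW ai0)//.
    by rewrite le_max lexx.
  by rewrite ge_max powR_ge0.
rewrite -[ltLHS]tK; apply: gt0_ltr_powR; rewrite ?nnegrE ?powR_ge0//.
  by rewrite le_max lexx.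
by rewrite lt_max tx orbT.
Qed.

(* Main.v *)
(** For [mu] a permuton, the number of points inverted with [(x, y)] is binomial
    with success probability [lambda(x, y) = x + y - 2 mu([0, x] * [0, y])]. By
    positivity of the density, [lambda] is bounded below away from [(0, 0)] and
    [(1, 1)], and next to these corners it is equivalent to [x + y] and to
    [(1 - x) + (1 - y)]. Exponential concentration, made uniform by a union
    bound over the [n^2] cells of a grid of mesh [1/n], then shows that outside
    an event of vanishing probability the minimal inversion exceeds [t sqrt n]
    if no point falls into the two corner triangles of side [s / sqrt n], for
    [s > t], and only if no point does so, for [s < t]. These triangles have
    area [s^2 / (2 n)], so no point falls into them with probability about
    [(1 - (f(0,0) + f(1,1)) s^2 / (2 n))^n]. *)

Require Import Defs.
From mathcomp Require Import all_boot all_order all_algebra.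
From mathcomp Require Import all_classical all_reals all_analysis.
From mathcomp Require Import measurable_realfun ring lra.
Import Order.TTheory GRing.Theory Num.Def Num.Theory.
Import numFieldNormedType.Exports.
Local Open Scope classical_set_scope.
Local Open Scope ring_scope.

(** * Counting independent points *)

Section real_probability.
Context {d : measure_display} {T : measurableType d} {R : realType}
  (P : probability T R).

Definition pr (A : set T) : R := fine (P A).

Lemma prE (A : set T) : measurable A -> P A = (pr A)%:E.
Proof. by move=> mA; rewrite fineK// fin_num_measure. Qed.

Lemma pr_ge0 (A : set T) : 0 <= pr A.
Proof. exact/fine_ge0/measure_ge0. Qed.

Lemma le_pr (A B : set T) : measurable A -> measurable B -> A `<=` B ->
  pr A <= pr B.
Proof. by move=> mA mB AB; rewrite -lee_fin -!prE// le_measure ?inE. Qed.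

Lemma pr_le1 (A : set T) : measurable A -> pr A <= 1.
Proof. by move=> mA; rewrite -lee_fin -prE// probability_le1. Qed.

Lemma pr_setC (A : set T) : measurable A -> pr (~` A) = 1 - pr A.
Proof.
move=> mA; apply: EFin_inj; rewrite -prE; last exact: measurableC.
by rewrite probability_setC// prE.
Qed.

Lemma prU (A B : set T) : measurable A -> measurable B -> A `&` B = set0 ->
  pr (A `|` B) = pr A + pr B.
Proof.
move=> mA mB AB; apply: EFin_inj; rewrite -prE; last exact: measurableU.
transitivity (P A + P B)%E; first exact: measureU.
by rewrite !prE.
Qed.

Lemma prU_le (A B : set T) : measurable A -> measurable B ->
  pr (A `|` B) <= pr A + pr B.
Proof.
move=> mA mB; rewrite -lee_fin EFinD -!prE//; last exact: measurableU.
exact: measureU2.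
Qed.

Lemma prD_le (A B : set T) : measurable A -> measurable B ->
  pr A - pr B <= pr (A `\` B).
Proof.
move=> mA mB; rewrite lerBlDr.
have mD : measurable (A `\` B) by exact: measurableD.
apply: le_trans (prU_le _ _ mD mB); apply: le_pr => //; first exact: measurableU.
by move=> x Ax; have [Bx|nBx] := pselect (B x); [right | left].
Qed.

(** The union bound, to be applied to the [n * n] cells of the grid. *)
Lemma pr_bigsetU_le (I : Type) (s : seq I) (A : I -> set T) (e : R) :
  (forall i, measurable (A i)) -> (forall i, pr (A i) <= e) ->
  pr (\big[setU/set0]_(i <- s) A i) <= (size s)%:R * e.
Proof.
move=> mA Ae; elim: s => [|i s IH].
  by rewrite big_nil mul0r /pr measure0.
rewrite big_cons /=; apply: (le_trans (prU_le _ _ _ _)) => //.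
  by apply: bigsetU_measurable.
by rewrite -natr1 mulrDl mul1r addrC lerD.
Qed.

Lemma pr_bigsetU (I : eqType) (s : seq I) (Q : pred I) (A : I -> set T) :
  uniq s -> (forall i, measurable (A i)) -> trivIset setT A ->
  pr (\big[setU/set0]_(i <- s | Q i) A i) = \sum_(i <- s | Q i) pr (A i).
Proof.
move=> + mA tA; elim: s => [|i s IH] /=; first by rewrite !big_nil /pr measure0.
case/andP=> nis us; rewrite !big_cons; case: ifP => // Qi; last exact: IH.
rewrite prU ?IH//; first by apply: bigsetU_measurable.
rewrite big_distrr/= big_seq_cond big1// => j /andP[js _].
apply/eqP/negPn/negP => /set0P[x [Aix Ajx]].
have ij : i = j by apply: tA => //; exists x.
by move: nis; rewrite ij js.
Qed.

End real_probability.

(** * Exponential moments of the number of points in a fixed set *)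

Section independent_counts.
Context {R : realType} {n : nat} {d : measure_display} {W : measurableType d}
  {P : probability W R} {d' : measure_display} {T : measurableType d'}
  {mu : probability T R} (Z : 'I_n -> {RV P >-> T}).
Hypothesis Z_iid : iid mu Z.

Let pre (A : 'I_n -> set T) : set W := \bigcap_(i in setT) (Z i @^-1` A i).

Lemma measurable_preimage_RV i (A : set T) :
  measurable A -> measurable (Z i @^-1` A).
Proof. by move=> mA; rewrite -[X in measurable X]setTI; apply: measurable_funPT. Qed.

Let mpre A : (forall i, measurable (A i)) -> measurable (pre A).
Proof.
move=> mA; apply: fin_bigcap_measurable => // i _.
exact: measurable_preimage_RV.
Qed.

Let pr_pre A : (forall i, measurable (A i)) ->
  pr P (pre A) = \prod_(i < n) pr mu (A i).
Proof.
move=> mA; apply: EFin_inj; rewrite -prE; last exact: mpre.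
have [ind dist] := Z_iid.
have := ind [set: 'I_n]%SET A mA.
have -> : [set` [set: 'I_n]%SET] = setT :> set 'I_n.
  by apply/seteqP; split => x //=; rewrite inE.
rewrite /pre => ->; rewrite -prodEFin; apply: eq_big => [i|i _].
  by rewrite inE.
by rewrite -prE// -(dist i).
Qed.

Lemma pr_all_in (A : set T) : measurable A ->
  measurable [set w | forall i, A (Z i w)] /\
  pr P [set w | forall i, A (Z i w)] = pr mu A ^+ n.
Proof.
move=> mA; have -> : [set w | forall i, A (Z i w)] = pre (fun=> A).
  by apply/seteqP; split => [w Aw i _|w Aw i] /=; [exact: Aw | exact: (Aw i)].
split; first by apply: mpre.
by rewrite pr_pre// prodr_const card_ord.
Qed.

(** The random index set is kept, not just its cardinality: the events [hits A w = J] are product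
    events, so independence gives their exact probabilities, and they partition the sample space. *)
Definition hits (A : set T) (w : W) : {set 'I_n} :=
  [set i | Z i w \in A]%SET.

Let hits_eq (A : set T) (J : {set 'I_n}) : [set w | hits A w = J] =
  pre (fun i => if i \in J then A else ~` A).
Proof.
apply/seteqP; split => [w /= <- i _ /=|w /= h].
  by rewrite inE; case: ifPn; rewrite ?inE// notin_setE.
apply/setP => i; have /= := h i I; rewrite inE.
by case: ifPn => iJ Ai; [rewrite mem_set | apply/negbTE; rewrite notin_setE].
Qed.

Let mhits (A : set T) (J : {set 'I_n}) : measurable A ->
  measurable [set w | hits A w = J].
Proof.
move=> mA; rewrite hits_eq; apply: mpre => i.
by case: ifP => _ //; exact: measurableC.
Qed.

Let hits_pred (A : set T) (Q : pred {set 'I_n}) : [set w | Q (hits A w)] =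
  \big[setU/set0]_(J <- index_enum {set 'I_n} | Q J) [set w | hits A w = J].
Proof.
rewrite -bigcup_seq_cond; apply/seteqP; split => [w /= Qw|w /= [J] /= /andP[_ QJ] ->//].
  by exists (hits A w) => //=; rewrite mem_index_enum.
Qed.

Lemma measurable_hits (A : set T) (Q : pred {set 'I_n}) : measurable A ->
  measurable [set w | Q (hits A w)].
Proof.
move=> mA; rewrite hits_pred; apply: bigsetU_measurable => J _; exact: mhits.
Qed.

(* Both tails at once: the sign of [th] selects the tail. *)
Lemma chernoff (A : set T) (th k : R) : measurable A ->
  pr P [set w | 0 <= th * (#|hits A w|%:R - k)] <=
  expR (n%:R * pr mu A * (expR th - 1) - th * k).
Proof.
move=> mA; rewrite (hits_pred A (fun J => 0 <= th * (#|J|%:R - k))).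
rewrite pr_bigsetU ?index_enum_uniq//; first last.
- by move=> I J _ _ [w [/= <- <-]].
- by move=> J; exact: mhits.
have prJ J : pr P [set w | hits A w = J] =
    \prod_(i < n) (if i \in J then pr mu A else 1 - pr mu A).
  rewrite hits_eq pr_pre; last first.
    by move=> i; case: ifP => _ //; exact: measurableC.
  by apply: eq_bigr => i _; case: ifP => // _; rewrite pr_setC.
have prJ_ge0 (J : {set 'I_n}) : 0 <= \prod_(i < n) (if i \in J then pr mu A else 1 - pr mu A).
  by apply: prodr_ge0 => i _; case: ifP => _; rewrite ?pr_ge0// subr_ge0 pr_le1.
(* Markov's inequality term by term: on the event the factor [expR (th * (#|J| - k))] is at least 1,
   and its part depending on [J] is spread as one factor [expR th] for each element of [J]. *)
have step : \sum_(J : {set 'I_n} | 0 <= th * (#|J|%:R - k))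
      pr P [set w | hits A w = J] <=
    \sum_(J : {set 'I_n}) expR (- (th * k)) *
      \prod_(i < n) (if i \in J then expR th * pr mu A else 1 - pr mu A).
  rewrite big_mkcond; apply: ler_sum => J _.
  have -> : \prod_(i < n) (if i \in J then expR th * pr mu A else 1 - pr mu A) =
    expR (th * #|J|%:R) *
      \prod_(i < n) (if i \in J then pr mu A else 1 - pr mu A).
    rewrite expRM_natr -prodr_const [X in _ = X * _]big_mkcond/= -big_split/=.
    by apply: eq_bigr => i _; case: ifP => _; rewrite ?mul1r.
  rewrite mulrA -expRD; case: ifP => hJ; last by rewrite mulr_ge0 ?expR_ge0.
  rewrite prJ ler_peMl//; apply: le_trans (expR_ge1Dx _).
  rewrite lerDl; apply: (le_trans hJ).
  by rewrite mulrBr addrC.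
(* With [p = pr mu A], the sum over all [J] is the expansion of the power
   [(1 - p + p * expR th) ^+ n], and [1 + x <= expR x] bounds its base. *)
apply: (le_trans step); rewrite -big_distrr/= -bigA_distr/=.
rewrite prodr_const card_ord [leRHS]expRD mulrC ler_pM2r ?expR_gt0//.
rewrite -mulrA expRM_natl.
apply: lerXn2r; rewrite ?nnegrE ?expR_ge0//.
  by rewrite addr_ge0 ?mulr_ge0 ?expR_ge0 ?pr_ge0// subr_ge0 pr_le1.
by apply: le_trans (expR_ge1Dx _); lra.
Qed.

End independent_counts.
(** * Permutons near and away from the corners *)

Section triangle_area.
Context {R : realType}.

Definition triangle00 (r : R) : set (R * R) :=
  [set w | [/\ 0 <= w.1, 0 <= w.2 & w.1 + w.2 <= r]].

Definition triangle11 (r : R) : set (R * R) :=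
  [set w | [/\ w.1 <= 1, w.2 <= 1 & 2 - r <= w.1 + w.2]].

Lemma integral_affine (a b c e : R) : a < b ->
  (\int[@lebesgue_measure R]_(x in `[a, b]) (e * (x - c))%:E =
   (e / 2 * ((b - c) ^+ 2 - (a - c) ^+ 2))%:E)%E.
Proof.
move=> ab; pose F (x : R) : R := e / 2 * (x - c) ^+ 2.
have dF (x : R) : is_derive x 1 F (e * (x - c)).
  rewrite /F; apply: is_derive_eq; rewrite /GRing.scale/=; by field.
have cF (x : R) : {for x, continuous F}.
  by apply: differentiable_continuous; apply/derivable1_diffP/ex_derive.
rewrite (@continuous_FTC2 _ _ F)//.
- by rewrite -EFinB /F mulrBr.
- apply: continuous_subspaceT => x.
  apply: cvgM; first exact: cvg_cst.
  by apply: cvgB => //; exact: cvg_cst.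
- split => [x _||].
  + exact: ex_derive.
  + exact/cvg_at_right_filter/cF.
  + exact/cvg_at_left_filter/cF.
- by move=> x _; rewrite derive1E derive_val.
Qed.

(** The area is the integral of the slice lengths, here affine in [x]. The parameters [e] and [c]
    cover both corner triangles: lengths [r - x] at (0, 0) and [x - (1 - r)] at (1, 1). *)
Lemma slice_area (A : set (R * R)) (l : R -> R) (a b c e : R) : a < b ->
  (forall x, a <= x <= b ->
    0 <= e * (x - c) /\ xsection A x = `[l x, l x + e * (x - c)]%classic) ->
  (forall x, ~~ (a <= x <= b) -> xsection A x = set0) ->
  ((@lebesgue_measure R \x @lebesgue_measure R) A =
   (e / 2 * ((b - c) ^+ 2 - (a - c) ^+ 2))%:E)%E.
Proof.
move=> ab Ain Aout; rewrite -integral_affine// integral_mkcond.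
apply: eq_integral => x _; rewrite /= patchE.
have [xab|xab] := boolP (a <= x <= b).
  rewrite mem_set/= ?in_itv//.
  have [+ ->] := Ain _ xab; rewrite le_eqVlt => /orP[/eqP <-|xc].
    by rewrite addr0 set_itv1 lebesgue_measure_set1.
  by rewrite lebesgue_measure_itv/= lte_fin ltrDl xc -EFinB addrC addKr.
by rewrite memNset/= ?in_itv/= ?Aout// ?measure0//; exact/negP.
Qed.

Lemma triangle_area00 (r : R) : 0 < r ->
  ((@lebesgue_measure R \x @lebesgue_measure R) (triangle00 r) =
   (r ^+ 2 / 2)%:E)%E.
Proof.
move=> r0; rewrite (@slice_area _ (fun=> 0) 0 r r (- 1))//.
- by congr EFin; field.
- move=> x x0r; split; first lra.
  apply/seteqP; split => y; rewrite /xsection/= inE/= in_itv/=.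
    by case=> /= ? ? ?; lra.
  by move=> ?; split => /=; lra.
- move=> x x0r; rewrite -subset0 => y; rewrite /xsection/= inE/= => -[/= ? ? ?].
  by case/negP: x0r; lra.
Qed.

Lemma triangle_area11 (r : R) : 0 < r ->
  ((@lebesgue_measure R \x @lebesgue_measure R) (triangle11 r) =
   (r ^+ 2 / 2)%:E)%E.
Proof.
move=> r0; rewrite (@slice_area _ (fun x => 2 - r - x) (1 - r) 1 (1 - r) 1)//.
- by congr EFin; field.
- lra.
- move=> x x0r; split; first lra.
  apply/seteqP; split => y; rewrite /xsection/= inE/= in_itv/=.
    by case=> /= ? ? ?; lra.
  by move=> ?; split => /=; lra.
- move=> x x0r; rewrite -subset0 => y; rewrite /xsection/= inE/= => -[/= ? ? ?].
  by case/negP: x0r; lra.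
Qed.

End triangle_area.

(** * Bounds on the mass of a set from its area *)

Section density_bounds.
Context {R : realType} {mu : probability (R * R)%type R} {f : R * R -> R}.
Hypothesis f_density : is_density mu f.
Hypothesis f_pos : forall p, unit_square p -> 0 < f p.

Let lambda2 := (@lebesgue_measure R \x @lebesgue_measure R)%E.

Let mf (A : set (R * R)) : measurable A -> A `<=` unit_square ->
  measurable_fun A (EFin \o f).
Proof.
move=> mA AU; apply/measurable_EFinP; apply: measurable_funS AU f_density.1.
by apply: measurableX; exact: measurable_itv.
Qed.

Lemma density_le (A : set (R * R)) (a M : R) : measurable A ->
  A `<=` unit_square -> lambda2 A = a%:E -> 0 <= M ->
  (forall p, A p -> f p <= M) -> pr mu A <= M * a.
Proof.
move=> mA AU Aa M0 fM; rewrite -lee_fin -prE// f_density.2// EFinM -Aa.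
rewrite -integral_cst//; apply: ge0_le_integral => //.
- by move=> p /AU/f_pos/ltW; rewrite lee_fin.
- exact: mf.
Qed.

Lemma density_ge (A : set (R * R)) (a m : R) : measurable A ->
  A `<=` unit_square -> lambda2 A = a%:E -> 0 <= m ->
  (forall p, A p -> m <= f p) -> m * a <= pr mu A.
Proof.
move=> mA AU Aa m0 fm; rewrite -lee_fin -prE// f_density.2// EFinM -Aa.
rewrite -integral_cst//; apply: ge0_le_integral => //.
exact: mf.
Qed.

(** A vanishing integral would force [f = 0] almost everywhere on [A]; as [f > 0] there, [A] would
    be contained in a null set. No uniform lower bound on [f] enters. *)
Lemma density_gt0 (A : set (R * R)) : measurable A -> A `<=` unit_square ->
  (0 < lambda2 A)%E -> 0 < pr mu A.
Proof.
move=> mA AU A0; rewrite lt_neqAle pr_ge0 andbT eq_sym; apply/eqP => prA0.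
have intA0 : (\int[lambda2]_(p in A) `|(EFin \o f) p| = 0)%E.
  rewrite -[RHS]/(0%:E)%E -prA0 -prE// f_density.2//.
  by apply: eq_integral => p /set_mem/AU/f_pos/ltW fp; rewrite gee0_abs.
have [N [mN N0 AN]] := (ae_eq_integral_abs
  (@lebesgue_measure R \x @lebesgue_measure R)%E mA (mf _ mA AU)).1 intA0.
have : (lambda2 A <= lambda2 N)%E.
  apply: le_measure; rewrite ?inE// => p Ap; apply: AN => /= /(_ Ap)[] fp0.
  by have := f_pos _ (AU _ Ap); rewrite fp0 ltxx.
have -> : lambda2 N = 0%E by exact: N0.
by rewrite leNgt A0.
Qed.

End density_bounds.

Lemma square_continuous_dist {R : realType} (f : R * R -> R) (p : R * R)
  (e : R) : square_continuous_at f p -> 0 < e ->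
  exists2 r : R, 0 < r & forall q, unit_square q ->
    `|p.1 - q.1| <= r -> `|p.2 - q.2| <= r -> `|f p - f q| <= e.
Proof.
move=> fp e0; move/cvgrPdist_le : fp => /(_ e e0).
rewrite near_withinE => /nbhs_ballP[r /= r0 pr].
(* Halving the radius turns the open ball into closed conditions on the coordinates. *)
exists (r / 2); first by rewrite divr_gt0.
move=> q Uq q1 q2; apply: pr => //.
by split; rewrite /ball/=; lra.
Qed.

(** * Regions of inverted points *)

Section crossing_sets.
Context {R : realType}.

Lemma measurable_le_set (g h : R * R -> R) :
  measurable_fun setT g -> measurable_fun setT h ->
  measurable [set w | g w <= h w].
Proof. by move=> mg mh; rewrite -[X in measurable X]setTI; exact: measurable_fun_le. Qed.

Lemma measurable_lt_set (g h : R * R -> R) :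
  measurable_fun setT g -> measurable_fun setT h ->
  measurable [set w | g w < h w].
Proof.
move=> mg mh; have -> : [set w | g w < h w] = ~` [set w | h w <= g w].
  by apply/seteqP; split => w /=; rewrite ltNge => /negP.
by apply: measurableC; exact: measurable_le_set.
Qed.

Lemma measurable_unit_square : measurable (@unit_square R).
Proof. by apply: measurableX; exact: measurable_itv. Qed.

Lemma unit_squareE (w : R * R) :
  unit_square w <-> [/\ 0 <= w.1, w.1 <= 1, 0 <= w.2 & w.2 <= 1].
Proof.
rewrite /unit_square /=; split; rewrite ?in_itv/=.
  by case=> /andP[? ?] /andP[? ?]; split.
by case=> ? ? ? ?; split; apply/andP.
Qed.

(* [crossing x y x y] is the set of points inverted with [(x, y)]; moving the
   four bounds apart gives the inner and outer approximations of this set when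
   [(x, y)] is only known up to a grid cell. *)
Definition crossing (a b a' b' : R) : set (R * R) :=
  [set w | w.1 < a /\ b' < w.2 \/ a' < w.1 /\ w.2 < b].

Lemma crossing_subset (a b a' b' u v u' v' : R) :
  u <= a -> v <= b -> a' <= u' -> b' <= v' ->
  crossing u v u' v' `<=` crossing a b a' b'.
Proof. by move=> ? ? ? ? w [[? ?]|[? ?]]; [left|right]; split; lra. Qed.

Lemma measurable_upper_left (a b : R) :
  measurable [set w : R * R | w.1 < a /\ b < w.2].
Proof. by apply: measurableI; apply: measurable_lt_set. Qed.

Lemma measurable_lower_right (a b : R) :
  measurable [set w : R * R | a < w.1 /\ w.2 < b].
Proof. by apply: measurableI; apply: measurable_lt_set. Qed.

Lemma measurable_crossing (a b a' b' : R) : measurable (crossing a b a' b').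
Proof.
by apply: measurableU; [exact: measurable_upper_left | exact: measurable_lower_right].
Qed.

End crossing_sets.

(** * Mass of these regions under a permuton *)

Section permuton.
Context {R : realType} {mu : probability (R * R)%type R}.
Hypothesis mu_permuton : is_permuton mu.

Lemma pr_unit_square (A : set (R * R)) : measurable A ->
  pr mu (A `&` unit_square) = pr mu A.
Proof.
move=> mA; have mU := @measurable_unit_square R.
apply/eqP; rewrite eq_le le_pr//=; last exact: measurableI.
rewrite -[leRHS]addr0 -(_ : pr mu (~` unit_square) = 0); last first.
  by rewrite pr_setC// /pr mu_permuton.1/= subrr.
apply: le_trans (prU_le _ _ _ (measurableI _ _ mA mU) (measurableC mU)).
apply: le_pr => //.
  by apply: measurableU; [exact: measurableI | exact: measurableC].
by move=> w Aw; have [Uw|nUw] := pselect (unit_square w); [left | right].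
Qed.

Lemma pr_fst (B : set R) : measurable B ->
  pr mu [set w | B w.1] = fine (lebesgue_measure (B `&` `[0, 1])).
Proof.
move=> mB; have mB' : measurable [set w : R * R | B w.1].
  by rewrite -[X in measurable X]setTI; exact: measurable_fst.
rewrite -pr_unit_square// /pr -(mu_permuton.2 _ _ _).2; first last.
- by move=> x [].
- by apply: measurableI => //; exact: measurable_itv.
by congr (fine (mu _)); apply/seteqP; split => [w [? [? ?]]//|w [[? ?] ?]].
Qed.

Lemma pr_snd (B : set R) : measurable B ->
  pr mu [set w | B w.2] = fine (lebesgue_measure (B `&` `[0, 1])).
Proof.
move=> mB; have mB' : measurable [set w : R * R | B w.2].
  by rewrite -[X in measurable X]setTI; exact: measurable_snd.
rewrite -pr_unit_square// /pr -(mu_permuton.2 _ _ _).1; first last.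
- by move=> x [].
- by apply: measurableI => //; exact: measurable_itv.
by congr (fine (mu _)); apply/seteqP; split => [w [? [? ?]]//|w [? [? ?]]].
Qed.

Let lt_length (a : R) : 0 <= a <= 1 ->
  fine (lebesgue_measure ([set x | x < a] `&` `[0, 1])) = a.
Proof.
move=> a01; have -> : [set x | x < a] `&` `[0, 1] = `[0, a[%classic :> set R.
  by apply/seteqP; split => x /=; rewrite !in_itv/=; [case=> ?|move=> ?; split]; lra.
rewrite lebesgue_measure_itv/= lte_fin; case: ifPn => /= a0; lra.
Qed.

Let gt_length (a : R) : 0 <= a <= 1 ->
  fine (lebesgue_measure ([set x | a < x] `&` `[0, 1])) = 1 - a.
Proof.
move=> a01; have -> : [set x | a < x] `&` `[0, 1] = `]a, 1]%classic :> set R.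
  by apply/seteqP; split => x /=; rewrite !in_itv/=; [case=> ?|move=> ?; split]; lra.
rewrite lebesgue_measure_itv/= lte_fin; case: ifPn => /= a0; lra.
Qed.

Let measurable_ltR (a : R) : measurable [set x | x < a].
Proof. by rewrite -set_itvNyo; exact: measurable_itv. Qed.

Let measurable_gtR (a : R) : measurable [set x | a < x].
Proof. by rewrite -set_itvoy; exact: measurable_itv. Qed.

Lemma pr_fst_lt (a : R) : 0 <= a <= 1 -> pr mu [set w | w.1 < a] = a.
Proof. by move=> a01; rewrite (pr_fst _ (measurable_ltR a)) lt_length. Qed.

Lemma pr_snd_lt (a : R) : 0 <= a <= 1 -> pr mu [set w | w.2 < a] = a.
Proof. by move=> a01; rewrite (pr_snd _ (measurable_ltR a)) lt_length. Qed.

Lemma pr_fst_gt (a : R) : 0 <= a <= 1 -> pr mu [set w | a < w.1] = 1 - a.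
Proof. by move=> a01; rewrite (pr_fst _ (measurable_gtR a)) gt_length. Qed.

Lemma pr_snd_gt (a : R) : 0 <= a <= 1 -> pr mu [set w | a < w.2] = 1 - a.
Proof. by move=> a01; rewrite (pr_snd _ (measurable_gtR a)) gt_length. Qed.

Let mfst_lt (a : R) : measurable [set w : R * R | w.1 < a].
Proof. exact: measurable_lt_set. Qed.
Let msnd_lt (a : R) : measurable [set w : R * R | w.2 < a].
Proof. exact: measurable_lt_set. Qed.
Let mfst_gt (a : R) : measurable [set w : R * R | a < w.1].
Proof. exact: measurable_lt_set. Qed.
Let msnd_gt (a : R) : measurable [set w : R * R | a < w.2].
Proof. exact: measurable_lt_set. Qed.

(** The region is covered by the strips [w.1 < a] and [w.2 < b], whose masses are [a] and [b]
    because the marginals are uniform. *)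
Lemma pr_crossing_le00 (a b a' b' : R) : 0 <= a <= 1 -> 0 <= b <= 1 ->
  pr mu (crossing a b a' b') <= a + b.
Proof.
move=> a01 b01; rewrite -{2}(pr_fst_lt _ a01) -{2}(pr_snd_lt _ b01).
apply: le_trans (prU_le _ _ _ (mfst_lt a) (msnd_lt b)).
apply: le_pr; [exact: measurable_crossing | exact: measurableU |].
by move=> w [[? ?]|[? ?]]; [left | right].
Qed.

(** The same cover, with the strips [a' < w.1] and [b' < w.2] on the opposite sides. *)
Lemma pr_crossing_le11 (a b a' b' : R) : 0 <= a' <= 1 -> 0 <= b' <= 1 ->
  pr mu (crossing a b a' b') <= (1 - a') + (1 - b').
Proof.
move=> a01 b01; rewrite -(pr_fst_gt _ a01) -(pr_snd_gt _ b01).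
apply: le_trans (prU_le _ _ _ (mfst_gt a') (msnd_gt b')).
apply: le_pr; [exact: measurable_crossing | exact: measurableU |].
by move=> w [[? ?]|[? ?]]; [right | left].
Qed.

Lemma pr_crossing (a b a' b' : R) : a <= a' ->
  pr mu (crossing a b a' b') =
  pr mu [set w | w.1 < a /\ b' < w.2] + pr mu [set w | a' < w.1 /\ w.2 < b].
Proof.
move=> aa'; rewrite prU//.
- exact: measurable_upper_left.
- exact: measurable_lower_right.
by rewrite -subset0 => w [[? ?] [? ?]]; lra.
Qed.

Variable f : R * R -> R.
Hypothesis f_density : is_density mu f.
Hypothesis f_pos : forall p, unit_square p -> 0 < f p.

(** Inclusion in the rectangle is asked for only inside the unit square, which carries all the mass;
    this allows half-planes and quadrants as [A]. *)
Let pr_rectangle_le (a b a' b' M : R) (A : set (R * R)) : measurable A ->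
  0 <= a -> a <= b -> b <= 1 -> 0 <= a' -> a' <= b' -> b' <= 1 -> 0 <= M ->
  (forall w, a <= w.1 <= b -> a' <= w.2 <= b' -> f w <= M) ->
  (forall w, unit_square w -> A w -> a <= w.1 <= b /\ a' <= w.2 <= b') ->
  pr mu A <= M * ((b - a) * (b' - a')).
Proof.
move=> mA a0 ab b1 a'0 ab' b'1 M0 fM Aab.
have mB : measurable (`[a, b] `*` `[a', b'] : set (R * R)).
  by apply: measurableX; exact: measurable_itv.
have length (x y : R) : x <= y ->
    lebesgue_measure (`[x, y]%classic : set R) = (y - x)%:E.
  rewrite le_eqVlt => /orP[/eqP ->|xy].
    by rewrite set_itv1 lebesgue_measure_set1 subrr.
  by rewrite lebesgue_measure_itv/= lte_fin xy EFinB.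
apply: (@le_trans _ _ (pr mu (`[a, b] `*` `[a', b']))); last first.
  apply: (density_le f_density f_pos _ _ _ mB) => //.
  - by move=> w Bw; apply/unit_squareE; move: Bw => [/=]; rewrite !in_itv/= => ? ?; split; lra.
  - by rewrite product_measure1E// EFinM; congr (_ * _)%E; exact: length.
  - by move=> w [/=]; rewrite !in_itv/=; exact: fM.
rewrite -pr_unit_square//; apply: le_pr => //.
  by apply: measurableI => //; exact: measurable_unit_square.
by move=> w [Aw Uw]; have := Aab w Uw Aw; rewrite /= !in_itv.
Qed.

(** Each half of the region is a strip, of mass [u] or [v], minus a rectangle at the corner. The
    rectangles have mass at most [M * u * v'] and [M * u' * v], so near (0, 0) the loss relative to
    [u + v] is at most [M * r]. *)
Lemma pr_crossing_ge00 (u v u' v' r M : R) :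
  0 <= u -> u <= u' -> u' <= r -> 0 <= v -> v <= v' -> v' <= r -> r <= 1 ->
  0 <= M -> (forall w, 0 <= w.1 <= r -> 0 <= w.2 <= r -> f w <= M) ->
  (u + v) * (1 - M * r) <= pr mu (crossing u v u' v').
Proof.
move=> u0 uu' u'r v0 vv' v'r r1 M0 fM; rewrite pr_crossing//.
have A1 : u - M * (u * v') <= pr mu [set w | w.1 < u /\ v' < w.2].
  have mB : measurable [set w : R * R | w.1 < u /\ w.2 <= v'].
    by apply: measurableI; (apply: measurable_le_set || apply: measurable_lt_set).
  have B1 : pr mu [set w | w.1 < u /\ w.2 <= v'] <= M * ((u - 0) * (v' - 0)).
    apply: pr_rectangle_le => //; try lra.
    - by move=> w ? ?; apply: fM; lra.
    - by move=> w /unit_squareE[? ? ? ?] [? ?]; split; lra.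
  rewrite !subr0 in B1; rewrite -{1}(pr_fst_lt u); last lra.
  apply: (le_trans (lerB (lexx _) B1)); apply: (le_trans (prD_le _ _ _ (mfst_lt u) mB)).
  apply: le_pr; [exact: measurableD | exact: measurable_upper_left |].
  by move=> w /= [wu wv]; split => //; rewrite ltNge; apply/negP => ?; apply: wv.
have A2 : v - M * (u' * v) <= pr mu [set w | u' < w.1 /\ w.2 < v].
  have mB : measurable [set w : R * R | w.1 <= u' /\ w.2 < v].
    by apply: measurableI; (apply: measurable_le_set || apply: measurable_lt_set).
  have B1 : pr mu [set w | w.1 <= u' /\ w.2 < v] <= M * ((u' - 0) * (v - 0)).
    apply: pr_rectangle_le => //; try lra.
    - by move=> w ? ?; apply: fM; lra.
    - by move=> w /unit_squareE[? ? ? ?] [? ?]; split; lra.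
  rewrite !subr0 in B1; rewrite -{1}(pr_snd_lt v); last lra.
  apply: (le_trans (lerB (lexx _) B1)); apply: (le_trans (prD_le _ _ _ (msnd_lt v) mB)).
  apply: le_pr; [exact: measurableD | exact: measurable_lower_right |].
  by move=> w /= [wu wv]; split => //; rewrite ltNge; apply/negP => ?; apply: wv.
apply: le_trans (lerD A1 A2).
have Mu : M * (u * v') <= M * (u * r) by rewrite ler_wpM2l ?ler_wpM2l.
have Mv : M * (u' * v) <= M * (r * v) by rewrite ler_wpM2l ?ler_wpM2r.
lra.
Qed.

(** The mirror image at (1, 1): the strips [v' < w.2] and [u' < w.1] lose rectangles at that
    corner. *)
Lemma pr_crossing_ge11 (u v u' v' r M : R) :
  1 - r <= u -> u <= u' -> u' <= 1 -> 1 - r <= v -> v <= v' -> v' <= 1 ->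
  r <= 1 -> 0 <= M ->
  (forall w, 1 - r <= w.1 <= 1 -> 1 - r <= w.2 <= 1 -> f w <= M) ->
  (1 - u' + (1 - v')) * (1 - M * r) <= pr mu (crossing u v u' v').
Proof.
move=> u0 uu' u'r v0 vv' v'r r1 M0 fM; rewrite pr_crossing//.
have A1 : 1 - v' - M * ((1 - u) * (1 - v')) <=
    pr mu [set w | w.1 < u /\ v' < w.2].
  have mB : measurable [set w : R * R | u <= w.1 /\ v' < w.2].
    by apply: measurableI; (apply: measurable_le_set || apply: measurable_lt_set).
  have B1 : pr mu [set w | u <= w.1 /\ v' < w.2] <= M * ((1 - u) * (1 - v')).
    apply: pr_rectangle_le => //; try lra.
    - by move=> w ? ?; apply: fM; lra.
    - by move=> w /unit_squareE[? ? ? ?] [? ?]; split; lra.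
  rewrite -{1}(pr_snd_gt v'); last lra.
  apply: (le_trans (lerB (lexx _) B1)); apply: (le_trans (prD_le _ _ _ (msnd_gt v') mB)).
  apply: le_pr; [exact: measurableD | exact: measurable_upper_left |].
  by move=> w /= [wu wv]; split => //; rewrite ltNge; apply/negP => ?; apply: wv.
have A2 : 1 - u' - M * ((1 - u') * (1 - v)) <=
    pr mu [set w | u' < w.1 /\ w.2 < v].
  have mB : measurable [set w : R * R | u' < w.1 /\ v <= w.2].
    by apply: measurableI; (apply: measurable_le_set || apply: measurable_lt_set).
  have B1 : pr mu [set w | u' < w.1 /\ v <= w.2] <= M * ((1 - u') * (1 - v)).
    apply: pr_rectangle_le => //; try lra.
    - by move=> w ? ?; apply: fM; lra.
    - by move=> w /unit_squareE[? ? ? ?] [? ?]; split; lra.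
  rewrite -{1}(pr_fst_gt u'); last lra.
  apply: (le_trans (lerB (lexx _) B1)); apply: (le_trans (prD_le _ _ _ (mfst_gt u') mB)).
  apply: le_pr; [exact: measurableD | exact: measurable_lower_right |].
  by move=> w /= [wu wv]; split => //; rewrite ltNge; apply/negP => ?; apply: wv.
apply: le_trans (lerD A1 A2).
have Mu : M * ((1 - u) * (1 - v')) <= M * (r * (1 - v')).
  by rewrite ler_wpM2l ?ler_wpM2r//; lra.
have Mv : M * ((1 - u') * (1 - v)) <= M * ((1 - u') * r).
  by rewrite ler_wpM2l ?ler_wpM2l//; lra.
lra.
Qed.

(** These squares sit at the other two corners, (0, 1) and (1, 0). *)
Let pr_corner_gt0 (r : R) : 0 < r -> r <= 1 ->
  0 < pr mu [set w | w.1 < r /\ 1 - r < w.2] /\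
  0 < pr mu [set w | 1 - r < w.1 /\ w.2 < r].
Proof.
move=> r0 r1; have lengthl : lebesgue_measure (`[0, r[%classic : set R) = r%:E.
  by rewrite lebesgue_measure_itv/= lte_fin r0 -EFinB subr0.
have lengthr : lebesgue_measure (`]1 - r, 1]%classic : set R) = r%:E.
  rewrite lebesgue_measure_itv/= lte_fin gtrBl r0 -EFinB.
  by congr EFin; lra.
split; [rewrite -(pr_unit_square _ (measurable_upper_left _ _))
  |rewrite -(pr_unit_square _ (measurable_lower_right _ _))].
- have -> : [set w | w.1 < r /\ 1 - r < w.2] `&` unit_square =
      `[0, r[ `*` `]1 - r, 1] :> set (R * R).
    apply/seteqP; split => w.
      by case=> [[/= ? ?]] /unit_squareE[? ? ? ?]; rewrite /= !in_itv/=; split; lra.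
    case; rewrite /= !in_itv/= => ? ?.
    by split; [split|apply/unit_squareE; split]; lra.
  apply: (density_gt0 f_density f_pos).
  + by apply: measurableX; exact: measurable_itv.
  + move=> w Bw; apply/unit_squareE; move: Bw => [/=]; rewrite !in_itv/= => ? ?; split; lra.
  rewrite product_measure1E; [|exact: measurable_itv..].
  by rewrite [X in (X * _)%E]lengthl [X in (_ * X)%E]lengthr lte_fin mulr_gt0.
- have -> : [set w | 1 - r < w.1 /\ w.2 < r] `&` unit_square =
      `]1 - r, 1] `*` `[0, r[ :> set (R * R).
    apply/seteqP; split => w.
      by case=> [[/= ? ?]] /unit_squareE[? ? ? ?]; rewrite /= !in_itv/=; split; lra.
    case; rewrite /= !in_itv/= => ? ?.
    by split; [split|apply/unit_squareE; split]; lra.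
  apply: (density_gt0 f_density f_pos).
  + by apply: measurableX; exact: measurable_itv.
  + move=> w Bw; apply/unit_squareE; move: Bw => [/=]; rewrite !in_itv/= => ? ?; split; lra.
  rewrite product_measure1E; [|exact: measurable_itv..].
  by rewrite [X in (_ * X)%E]lengthl [X in (X * _)%E]lengthr lte_fin mulr_gt0.
Qed.

(** For a cell away from (0, 0) and (1, 1), the inverted region contains one of two fixed squares of
    side [r / 2], at (0, 1) or at (1, 0); [c] is the smaller of their masses. *)
Lemma pr_crossing_away (r : R) : 0 < r -> r <= 2^-1 ->
  exists2 c : R, 0 < c & forall u v u' v',
    0 <= u -> u <= u' -> u' <= 1 -> u' - u <= r / 2 ->
    0 <= v -> v <= v' -> v' <= 1 -> v' - v <= r / 2 ->
    ~ (u' < r /\ v' < r) -> ~ (1 - r < u /\ 1 - r < v) ->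
    c <= pr mu (crossing u v u' v').
Proof.
move=> r0 r1.
have r20 : 0 < r / 2 by lra.
have [|c1 c2] := pr_corner_gt0 _ r20; first lra.
exists (Num.min (pr mu [set w | w.1 < r / 2 /\ 1 - r / 2 < w.2])
  (pr mu [set w | 1 - r / 2 < w.1 /\ w.2 < r / 2])).
  by rewrite lt_min c1 c2.
move=> u v u' v' u0 uu' u'1 ur v0 vv' v'1 vr n00 n11.
have mc := measurable_crossing u v u' v'.
have [/andP[? ?]|ul] := boolP ((r / 2 <= u) && (v' <= 1 - r / 2)).
  rewrite ge_min; apply/orP; left; apply: le_pr => //.
    exact: measurable_upper_left.
  by move=> w [? ?]; left; split; lra.
have [/andP[? ?]|lr] := boolP ((r / 2 <= v) && (u' <= 1 - r / 2)).
  rewrite ge_min; apply/orP; right; apply: le_pr => //.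
    exact: measurable_lower_right.
  by move=> w [? ?]; right; split; lra.
(* If neither square fits, then [u < r / 2] or [v' > 1 - r / 2], and [v < r / 2] or
   [u' > 1 - r / 2]. As the cell has sides at most [r / 2 <= 1 / 4], the mixed choices are
   impossible and the other two put the cell at an excluded corner. *)
exfalso; move: ul lr; rewrite !negb_and -!ltNge => /orP ul /orP lr.
have [u'r|u'r] := ltP u' r; have [v'r|v'r] := ltP v' r.
- exact: n00.
- by case: ul => ?; case: lr => ?; try lra; apply: n11; split; lra.
- by case: ul => ?; case: lr => ?; try lra; apply: n11; split; lra.
- by case: ul => ?; case: lr => ?; try lra; apply: n11; split; lra.
Qed.

End permuton.

(** * The corner triangles *)

Section corners.
Context {R : realType}.

Definition corners (r : R) : set (R * R) := triangle00 r `|` triangle11 r.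

Lemma measurable_triangle00 (r : R) : measurable (triangle00 r).
Proof.
have -> : triangle00 r = [set w | 0 <= w.1] `&` [set w | 0 <= w.2] `&`
    [set w | w.1 + w.2 <= r].
  by apply/seteqP; split => w /=; [case | case=> -[]].
by apply: measurableI; [apply: measurableI|]; apply: measurable_le_set => //;
  exact: measurable_funD.
Qed.

Lemma measurable_triangle11 (r : R) : measurable (triangle11 r).
Proof.
have -> : triangle11 r = [set w | w.1 <= 1] `&` [set w | w.2 <= 1] `&`
    [set w | 2 - r <= w.1 + w.2].
  by apply/seteqP; split => w /=; [case | case=> -[]].
by apply: measurableI; [apply: measurableI|]; apply: measurable_le_set => //;
  exact: measurable_funD.
Qed.

Lemma measurable_corners (r : R) : measurable (corners r).
Proof.
by apply: measurableU; [exact: measurable_triangle00 | exact: measurable_triangle11].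
Qed.

Lemma triangle00_subset (r : R) : r <= 1 -> triangle00 r `<=` unit_square.
Proof. by move=> r1 w [? ? ?]; apply/unit_squareE; split; lra. Qed.

Lemma triangle11_subset (r : R) : r <= 1 -> triangle11 r `<=` unit_square.
Proof. by move=> r1 w [? ? ?]; apply/unit_squareE; split; lra. Qed.

Variables (mu : probability (R * R)%type R) (f : R * R -> R).
Hypothesis mu_permuton : is_permuton mu.
Hypothesis f_density : is_density mu f.
Hypothesis f_pos : forall p, unit_square p -> 0 < f p.
Hypothesis f_cont0 : square_continuous_at f (0, 0).
Hypothesis f_cont1 : square_continuous_at f (1, 1).

Let sq00 : unit_square ((0, 0) : R * R).
Proof. by apply/unit_squareE; split => /=; lra. Qed.

Let sq11 : unit_square ((1, 1) : R * R).
Proof. by apply/unit_squareE; split => /=; lra. Qed.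

(** Each triangle has area [r ^+ 2 / 2], and continuity keeps the density on it close to its corner
    value. *)
Lemma pr_corners (e : R) : 0 < e ->
  exists2 r0 : R, 0 < r0 & forall r, 0 < r -> r <= r0 ->
    `|pr mu (corners r) - (f (0, 0) + f (1, 1)) / 2 * r ^+ 2| <= e * r ^+ 2.
Proof.
move=> e0; have f0 := f_pos _ sq00; have f1 := f_pos _ sq11.
(* Capping by the corner values keeps the lower bounds [f (0, 0) - e'] and [f (1, 1) - e']
   nonnegative, as [density_ge] requires. *)
pose e' := Num.min e (Num.min (f (0, 0)) (f (1, 1))).
have e'0 : 0 < e' by rewrite !lt_min e0 f0 f1.
have e'e : e' <= e by rewrite ge_min lexx.
have e'f0 : e' <= f (0, 0) by rewrite !ge_min lexx !orbT.
have e'f1 : e' <= f (1, 1) by rewrite !ge_min lexx !orbT.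
have [d0 d00 H0] := square_continuous_dist _ _ _ f_cont0 e'0.
have [d1 d10 H1] := square_continuous_dist _ _ _ f_cont1 e'0.
exists (Num.min 2^-1 (Num.min d0 d1)).
  by rewrite !lt_min d00 d10 invr_gt0 ltr0n.
move=> r r0; rewrite !le_min => /andP[r2 /andP[rd0 rd1]].
have r1 : r <= 1 by lra.
have F0 w : triangle00 r w -> `|f (0, 0) - f w| <= e'.
  by move=> Aw; apply: H0; [exact: triangle00_subset Aw|..];
    case: Aw => ? ? ?; rewrite /= sub0r normrN ger0_norm//; lra.
have F1 w : triangle11 r w -> `|f (1, 1) - f w| <= e'.
  by move=> Aw; apply: H1; [exact: triangle11_subset Aw|..];
    case: Aw => ? ? ?; rewrite /= ger0_norm//; lra.
have m0 := measurable_triangle00 r; have m1 := measurable_triangle11 r.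
have U0 : pr mu (triangle00 r) <= (f (0, 0) + e') * (r ^+ 2 / 2).
  apply: (density_le f_density f_pos _ _ _ m0).
  - exact: triangle00_subset.
  - exact: triangle_area00.
  - lra.
  - by move=> p /F0; rewrite ler_norml => /andP[]; lra.
have L0 : (f (0, 0) - e') * (r ^+ 2 / 2) <= pr mu (triangle00 r).
  apply: (density_ge f_density _ _ _ m0).
  - exact: triangle00_subset.
  - exact: triangle_area00.
  - lra.
  - by move=> p /F0; rewrite ler_norml => /andP[]; lra.
have U1 : pr mu (triangle11 r) <= (f (1, 1) + e') * (r ^+ 2 / 2).
  apply: (density_le f_density f_pos _ _ _ m1).
  - exact: triangle11_subset.
  - exact: triangle_area11.
  - lra.
  - by move=> p /F1; rewrite ler_norml => /andP[]; lra.
have L1 : (f (1, 1) - e') * (r ^+ 2 / 2) <= pr mu (triangle11 r).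
  apply: (density_ge f_density _ _ _ m1).
  - exact: triangle11_subset.
  - exact: triangle_area11.
  - lra.
  - by move=> p /F1; rewrite ler_norml => /andP[]; lra.
have -> : pr mu (corners r) = pr mu (triangle00 r) + pr mu (triangle11 r).
  rewrite prU// -subset0 => w [[? ? ?] [? ? ?]]; lra.
have : e' * r ^+ 2 <= e * r ^+ 2 by rewrite ler_wpM2r// sqr_ge0.
by rewrite ler_norml => ?; apply/andP; split; lra.
Qed.

(** Here [i] stands for [isqrt n], so a cell has side [i ^+ 2], of lower order than the scale [i] of
    the triangles. Close to (0, 0) or (1, 1) the mass is nearly the sum of the distances to the two
    sides, which exceeds [s * i] off the triangles; elsewhere it is bounded below by a constant. *)
Lemma pr_crossing_off_corners (s' s : R) : 0 <= s' -> s' < s ->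
  exists2 i0 : R, 0 < i0 & forall i u v z, 0 < i -> i <= i0 ->
    0 <= u -> u + i ^+ 2 <= 1 -> 0 <= v -> v + i ^+ 2 <= 1 ->
    u <= z.1 <= u + i ^+ 2 -> v <= z.2 <= v + i ^+ 2 ->
    ~ corners (s * i) z ->
    s' * i <= pr mu (crossing u v (u + i ^+ 2) (v + i ^+ 2)).
Proof.
move=> s'0 s's; have f0 := f_pos _ sq00; have f1 := f_pos _ sq11.
pose M := f (0, 0) + f (1, 1) + 1.
have M0 : 0 < M by rewrite /M; lra.
have [d0 d00 H0] := square_continuous_dist _ _ _ f_cont0 ltr01.
have [d1 d10 H1] := square_continuous_dist _ _ _ f_cont1 ltr01.
have s0 : 0 < s by lra.
(* The last term makes the density error [s * M * r] at most half of the gap [s - s']; the other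
   half pays for the size of the cells. *)
pose r := Num.min 2^-1 (Num.min (Num.min d0 d1) ((s - s') / (2 * s * M))).
have r0 : 0 < r.
  by rewrite !lt_min d00 d10 invr_gt0 ltr0n !divr_gt0 ?mulr_gt0// subr_gt0.
have : r <= r by [].
rewrite {2}/r !le_min => /and3P[r2 /andP[rd0 rd1] rs].
have Ms : s * (M * r) <= (s - s') / 2.
  have -> : (s - s') / 2 = s * (M * ((s - s') / (2 * s * M))).
    by field; rewrite !gt_eqF.
  apply: ler_wpM2l; first exact: ltW.
  by apply: ler_wpM2l => //; exact: ltW.
have Mr1 : M * r <= 1.
  rewrite -(ler_pM2l s0) mulr1; lra.
have Mr0 : 0 <= M * r by rewrite mulr_ge0// ltW.
have F0 w : 0 <= w.1 <= r -> 0 <= w.2 <= r -> f w <= M.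
  move=> w1 w2; have : `|f (0, 0) - f w| <= 1.
    apply: H0; first by apply/unit_squareE; split; lra.
      by rewrite /= sub0r normrN ger0_norm; lra.
    by rewrite /= sub0r normrN ger0_norm; lra.
  by rewrite ler_norml /M => /andP[]; lra.
have F1 w : 1 - r <= w.1 <= 1 -> 1 - r <= w.2 <= 1 -> f w <= M.
  move=> w1 w2; have : `|f (1, 1) - f w| <= 1.
    apply: H1; first by apply/unit_squareE; split; lra.
      by rewrite /= ger0_norm; lra.
    by rewrite /= ger0_norm; lra.
  by rewrite ler_norml /M => /andP[]; lra.
have [c c0 Hc] := pr_crossing_away mu_permuton _ f_density f_pos _ r0 r2.
(* The first two bounds give cells of side at most [r / 2], the third gives [s * i <= c], and the
   last bounds [2 * i ^+ 2] by half of the gap times [i]. *)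
exists (Num.min (Num.min 1 (r / 2)) (Num.min (c / s) ((s - s') / 4))).
  by rewrite !lt_min ltr01 !divr_gt0 ?subr_gt0//.
move=> i u v z i0; rewrite !le_min => /andP[/andP[i1 ir] /andP[ic is_]].
move=> u0 u1 v0 v1 z1 z2 nz.
have ii0 : 0 < i ^+ 2 by rewrite exprn_gt0.
have iir : i ^+ 2 <= r / 2.
  by apply: le_trans ir; rewrite expr2 ler_piMr// ltW.
have iis : i ^+ 2 <= (s - s') / 4 * i by rewrite expr2 ler_wpM2r// ltW.
clear f0 f1 d00 d10 rd0 rd1 rs H0 H1.
have n00 : s * i < z.1 + z.2.
  by rewrite ltNge; apply/negP => ?; apply: nz; left; split => //; lra.
have n11 : z.1 + z.2 < 2 - s * i.
  by rewrite ltNge; apply/negP => ?; apply: nz; right; split => //; lra.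
have key : s' * i <= (s * i - 2 * i ^+ 2) * (1 - M * r).
  have A1 : i * (s * (M * r)) <= i * ((s - s') / 2) by rewrite ler_wpM2l// ltW.
  have A2 : 2 * i ^+ 2 * (1 - M * r) <= 2 * i ^+ 2.
    by rewrite ler_piMr//; [rewrite mulr_ge0// ltW | lra].
  lra.
have Mr1' : 0 <= 1 - M * r by rewrite subr_ge0.
clear Ms Mr1 iis is_ nz.
(* The cell is near (0, 0), near (1, 1), or away from both. In the first two cases, replacing [z] by
   a corner of its cell costs at most [2 * i ^+ 2]. *)
have [[u'r v'r]|a00] := pselect (u + i ^+ 2 < r /\ v + i ^+ 2 < r).
  clear c0 ic Hc n11 s0 s'0 s's.
  apply: (le_trans key); apply: (@le_trans _ _ ((u + v) * (1 - M * r))).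
    by rewrite ler_wpM2r//; lra.
  by apply: (pr_crossing_ge00 mu_permuton _ f_density f_pos _ _ _ _ _ _ _ _ _ _ _ _ _ _ F0);
    clear key Mr1' Mr0; lra.
have [[u'r v'r]|a11] := pselect (1 - r < u /\ 1 - r < v).
  clear c0 ic Hc n00 s0 s'0 s's.
  apply: (le_trans key); apply: (@le_trans _ _
    ((1 - (u + i ^+ 2) + (1 - (v + i ^+ 2))) * (1 - M * r))).
    by rewrite ler_wpM2r//; lra.
  by apply: (pr_crossing_ge11 mu_permuton _ f_density f_pos _ _ _ _ _ _ _ _ _ _ _ _ _ _ F1);
    clear key Mr1' Mr0; lra.
clear key n00 n11 Mr1' Mr0 M0 s'0.
apply: (@le_trans _ _ c); last by apply: Hc => //; lra.
apply: (@le_trans _ _ (s * i)); first by rewrite ler_wpM2r// ltW.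
by move: ic; rewrite ler_pdivlMr// mulrC.
Qed.

(** The two covering strips have total width at most [s * i + 2 * i ^+ 2], and [i <= (s' - s) / 2]
    absorbs the second term. *)
Lemma pr_crossing_on_corners (s s' : R) : s < s' ->
  exists2 i0 : R, 0 < i0 & forall i u v z, 0 < i -> i <= i0 ->
    0 <= u -> u + i ^+ 2 <= 1 -> 0 <= v -> v + i ^+ 2 <= 1 ->
    u <= z.1 <= u + i ^+ 2 -> v <= z.2 <= v + i ^+ 2 ->
    corners (s * i) z ->
    pr mu (crossing (u + i ^+ 2) (v + i ^+ 2) u v) <= s' * i.
Proof.
move=> ss'; exists ((s' - s) / 2); first by rewrite divr_gt0// subr_gt0.
move=> i u v z i0 is_ u0 u1 v0 v1 z1 z2 cz.
have iis : i ^+ 2 <= (s' - s) / 2 * i by rewrite expr2 ler_wpM2r// ltW.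
have ii0 : 0 < i ^+ 2 by rewrite exprn_gt0.
case: cz => [[_ _ zs]|[_ _ zs]].
  by apply: le_trans (pr_crossing_le00 mu_permuton _ _ _ _ _ _) _; lra.
by apply: le_trans (pr_crossing_le11 mu_permuton _ _ _ _ _ _) _; lra.
Qed.

End corners.

(** * Limits and tail bounds *)

Section limits.
Context {R : realType}.

(** The scale of the corner triangles; its square is the mesh of the grid. *)
Definition isqrt (n : nat) : R := (Num.sqrt n%:R)^-1.

Lemma isqrt_gt0 (n : nat) : (0 < n)%N -> 0 < isqrt n.
Proof. by move=> n0; rewrite invr_gt0 sqrtr_gt0 ltr0n. Qed.

Lemma isqrt_sqr (n : nat) : isqrt n ^+ 2 = n%:R^-1.
Proof. by rewrite exprVn sqr_sqrtr. Qed.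

Lemma isqrt_cvg0 : isqrt n @[n --> \oo] --> (0 : R).
Proof.
apply/cvgrPdist_le => e e0; near=> n.
have n0 : (0 < n)%N by near: n; exists 1%N.
rewrite sub0r normrN gtr0_norm ?isqrt_gt0//.
have i0 := ltW (isqrt_gt0 _ n0).
rewrite -(@ler_pXn2r _ 2)// ?nnegrE ?(ltW e0)// isqrt_sqr.
rewrite invf_ple ?posrE ?exprn_gt0 ?ltr0n//.
near: n; exact: nbhs_infty_ger.
Unshelve. all: by end_near. Qed.

Lemma isqrt_sqr_cvg0 : isqrt n ^+ 2 @[n --> \oo] --> (0 : R).
Proof. by rewrite -[0 in X in _ --> X](mulr0 0); apply: cvgM; exact: isqrt_cvg0. Qed.

Lemma isqrt_near_le (i0 : R) : 0 < i0 ->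
  \forall n \near \oo, (0 < n)%N /\ isqrt n <= i0.
Proof.
move=> i00; near=> n; have n0 : (0 < n)%N by near: n; exists 1%N.
split => //; rewrite -[leLHS]gtr0_norm ?isqrt_gt0// -normrN -sub0r.
near: n; move/cvgrPdist_le : isqrt_cvg0; exact.
Unshelve. all: by end_near. Qed.

(** Squeeze by the [n]-th powers of [expR (- (x / (1 - x))) <= 1 - x <= expR (- x)]; convergence of
    [n * x n] forces [x n] to 0, so both bounds have the same limit. *)
Lemma cvg_expr_1B (x : nat -> R) (L : R) : (forall n, 0 <= x n) ->
  n%:R * x n @[n --> \oo] --> L -> (1 - x n) ^+ n @[n --> \oo] --> expR (- L).
Proof.
move=> x0 xL.
have x_cvg0 : x n @[n --> \oo] --> (0 : R).
  have : n%:R * x n * isqrt n ^+ 2 @[n --> \oo] --> L * 0.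
    by apply: cvgM => //; exact: isqrt_sqr_cvg0.
  rewrite mulr0; apply: cvg_trans; apply: near_eq_cvg; near=> n.
  have n0 : (0 < n)%N by near: n; exists 1%N.
  by rewrite isqrt_sqr; field; rewrite pnatr_eq0 -lt0n.
have x_lt1 : \forall n \near \oo, x n < 1.
  by move/cvgrPdist_lt : x_cvg0 => /(_ 1 ltr01); apply: filterS => n;
    rewrite sub0r normrN ger0_norm.
apply: (@squeeze_cvgr _ _ _ _ (fun n => expR (- (n%:R * x n / (1 - x n))))
    (fun n => expR (- (n%:R * x n)))).
- near=> n; have xn1 : x n < 1 by near: n.
  have x1 : 0 < 1 - x n by rewrite subr_gt0.
  rewrite -[n%:R * x n / _]mulrA -!(mulrN n%:R) !expRM_natl; apply/andP; split.
    apply: lerXn2r; rewrite ?nnegrE ?expR_ge0 ?(ltW x1)//.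
    rewrite expRN invf_ple ?posrE ?expR_gt0//.
    apply: le_trans (expR_ge1Dx _).
    by rewrite le_eqVlt; apply/orP; left; apply/eqP; field; rewrite gt_eqF.
  apply: lerXn2r; rewrite ?nnegrE ?expR_ge0 ?(ltW x1)//.
  exact: expR_ge1Dx.
- apply: continuous_cvg; first exact: continuous_expR.
  have -> : L = L / (1 - 0) by rewrite subr0 divr1.
  apply: cvgN; apply: cvgM => //; apply: cvgV; first by rewrite subr0 oner_neq0.
  by apply: cvgB => //; exact: cvg_cst.
- apply: continuous_cvg; first exact: continuous_expR.
  exact: cvgN.
Unshelve. all: by end_near. Qed.

(** This is the total failure probability over all cells. Since [(y / 6) ^+ 6 <= expR y] for
    [y >= 0], the exponential beats the third power of [n] up to a constant, leaving a bound
    [C / n]. *)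
Lemma cvg_sqr_expRN_sqrt (k : R) : 0 < k ->
  (n * n)%:R * expR (- (k / isqrt n)) @[n --> \oo] --> (0 : R).
Proof.
move=> k0; pose C := (6 / k) ^+ 6.
have C_cvg0 : C * isqrt n ^+ 2 @[n --> \oo] --> (0 : R).
  rewrite -(mulr0 C); apply: cvgM; first exact: cvg_cst.
  exact: isqrt_sqr_cvg0.
apply: (squeeze_cvgr _ (cvg_cst 0) C_cvg0); near=> n.
have n0 : (0 < n)%N by near: n; exists 1%N.
have i0 := isqrt_gt0 n n0.
rewrite mulr_ge0 ?expR_ge0//=.
have -> : (n * n)%:R = (isqrt n ^- 4 : R).
  rewrite (exprM _ 2 2) isqrt_sqr exprVn invrK natrM expr2//.
have E6 : (k / isqrt n / 6) ^+ 6 <= expR (k / isqrt n).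
  rewrite [in leRHS](_ : k / isqrt n = 6%:R * (k / isqrt n / 6)); last first.
    by field; rewrite gt_eqF.
  rewrite expRM_natl; apply: lerXn2r; rewrite ?nnegrE ?expR_ge0//.
    by rewrite !divr_ge0// ltW.
  by apply: le_trans (expR_ge1Dx _); rewrite lerDr.
rewrite expRN ler_pdivrMr ?expR_gt0//.
apply: le_trans (ler_wpM2l _ E6); last by rewrite mulr_ge0 ?exprn_ge0 ?divr_ge0// ltW.
rewrite le_eqVlt; apply/orP; left; apply/eqP; rewrite /C; field.
by rewrite !gt_eqF.
Unshelve. all: by end_near. Qed.

End limits.

(** * Tail bounds at scale [1 / isqrt n] *)

Section tails.
Context {R : realType} {d' : measure_display} {T : measurableType d'}
  {mu : probability T R}.

(** [chernoff] with a small negative parameter. The rate [k] depends on [t] and [s] only, which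
    makes the bound uniform over the cells and over [n]. *)
Lemma lower_tail (t s : R) : 0 <= t -> t < s ->
  exists2 k : R, 0 < k & forall n (d : measure_display) (W : measurableType d)
    (P : probability W R) (Z : 'I_n -> {RV P >-> T}) (A : set T),
    iid mu Z -> (0 < n)%N -> measurable A -> s * isqrt n <= pr mu A ->
    pr P [set w | #|hits Z A w|%:R <= t / isqrt n] <= expR (- (k / isqrt n)).
Proof.
(* By [1 - expR (- th) >= th / (1 + th)], a positive rate follows from [t * (1 + th) < s]. The
   denominator has [t + 1] because [t] may be 0. *)
move=> t0 ts; pose th := (s - t) / (2 * (t + 1)).
have t1 : 0 < 2 * (t + 1) by lra.
have th0 : 0 < th by rewrite divr_gt0// subr_gt0.
have tht : t * (1 + th) < s.
  have : t * th <= (s - t) / 2.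
    rewrite /th mulrA ler_pdivrMr//.
    have : 0 <= (s - t) * 1 by lra.
    nra.
  lra.
have Eth : th / (1 + th) <= 1 - expR (- th).
  have : expR (- th) <= (1 + th)^-1.
    by rewrite expRN lef_pV2 ?posrE ?expR_gt0 ?expR_ge1Dx//; lra.
  have -> : th / (1 + th) = 1 - (1 + th)^-1 by field; rewrite gt_eqF//; lra.
  lra.
exists (s * (1 - expR (- th)) - th * t).
  rewrite subr_gt0; apply: (@lt_le_trans _ _ (s * (th / (1 + th)))); last first.
    by rewrite ler_wpM2l//; lra.
  by rewrite mulrA ltr_pdivlMr; [nra | lra].
move=> n d W P Z A Ziid n0 mA sA; have i0 : 0 < isqrt n :> R := isqrt_gt0 n n0.
apply: (@le_trans _ _ (pr P [set w | 0 <= - th * (#|hits Z A w|%:R - t / isqrt n)])).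
  apply: le_pr.
  - exact: (measurable_hits _ A (fun J => #|J|%:R <= t / isqrt n)).
  - exact: (measurable_hits _ A
      (fun J => 0 <= - th * (#|J|%:R - t / isqrt n))).
  - by move=> w /= h; rewrite mulNr oppr_ge0 pmulr_rle0// subr_le0.
apply: (le_trans (chernoff _ Ziid A (- th) (t / isqrt n) mA)).
rewrite ler_expR.
have nE : n%:R = isqrt n ^- 2 :> R by rewrite isqrt_sqr invrK.
have E0 : 0 <= 1 - expR (- th) by apply: le_trans Eth; rewrite divr_ge0//; lra.
have : s / isqrt n * (1 - expR (- th)) <= n%:R * pr mu A * (1 - expR (- th)).
  apply: ler_wpM2r => //; have -> : s / isqrt n = n%:R * (s * isqrt n).
    by rewrite nE; field; rewrite gt_eqF.
  exact: ler_wpM2l.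
clear; lra.
Qed.

Lemma upper_tail (s t : R) : 0 <= s -> s < t ->
  exists2 k : R, 0 < k & forall n (d : measure_display) (W : measurableType d)
    (P : probability W R) (Z : 'I_n -> {RV P >-> T}) (A : set T),
    iid mu Z -> (0 < n)%N -> measurable A -> pr mu A <= s * isqrt n ->
    pr P [set w | t / isqrt n <= #|hits Z A w|%:R] <= expR (- (k / isqrt n)).
Proof.
(* By [expR th - 1 <= th / (1 - th)], a positive rate follows from [s < t * (1 - th)], whose
   right-hand side is the midpoint of [s] and [t]. *)
move=> s0 st; pose th := (t - s) / (2 * t).
have t1 : 0 < 2 * t by lra.
have th0 : 0 < th by rewrite divr_gt0// subr_gt0.
have tth : t * th = (t - s) / 2 by rewrite /th; field; rewrite gt_eqF//; lra.
have th1 : th < 1 by rewrite /th ltr_pdivrMr//; lra.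
have Eth : expR th - 1 <= th / (1 - th).
  have : expR th <= (1 - th)^-1.
    by rewrite -[th]opprK expRN opprK lef_pV2 ?posrE ?expR_gt0 ?expR_ge1Dx//; lra.
  have -> : th / (1 - th) = (1 - th)^-1 - 1 by field; rewrite gt_eqF//; lra.
  lra.
exists (th * t - s * (expR th - 1)).
  rewrite subr_gt0; apply: (@le_lt_trans _ _ (s * (th / (1 - th)))).
    by rewrite ler_wpM2l.
  by rewrite mulrA ltr_pdivrMr; [nra | lra].
move=> n d W P Z A Ziid n0 mA sA; have i0 : 0 < isqrt n :> R := isqrt_gt0 n n0.
apply: (@le_trans _ _ (pr P [set w | 0 <= th * (#|hits Z A w|%:R - t / isqrt n)])).
  apply: le_pr.
  - exact: (measurable_hits _ A (fun J => t / isqrt n <= #|J|%:R)).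
  - exact: (measurable_hits _ A
      (fun J => 0 <= th * (#|J|%:R - t / isqrt n))).
  - by move=> w /= h; rewrite pmulr_rge0// subr_ge0.
apply: (le_trans (chernoff _ Ziid A th (t / isqrt n) mA)).
rewrite ler_expR.
have nE : n%:R = isqrt n ^- 2 :> R by rewrite isqrt_sqr invrK.
have E0 : 0 <= expR th - 1 by rewrite subr_ge0 -expR0 ler_expR ltW.
have : n%:R * pr mu A * (expR th - 1) <= s / isqrt n * (expR th - 1).
  apply: ler_wpM2r => //; have -> : s / isqrt n = n%:R * (s * isqrt n).
    by rewrite nE; field; rewrite gt_eqF.
  exact: ler_wpM2l.
clear; lra.
Qed.

End tails.

(** * Inversions and the grid *)

Section minimal_inversion_theory.
Context {R : realType}.

Lemma ltr_minimal_inversion (n : nat) (z : 'I_n -> R * R) (k : R) :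
  (0 < n)%N ->
  k < (minimal_inversion z)%:R <-> forall i, k < #|Defs.Inv z i|%:R.
Proof.
move=> n0; rewrite /minimal_inversion; split=> [kz i|kz].
  apply: (lt_le_trans kz); rewrite ler_nat.
  have : i \in index_enum 'I_n by rewrite mem_index_enum.
  elim: (index_enum 'I_n) => // j s IH; rewrite inE big_cons.
  by move=> /orP[/eqP <-|/IH]; [exact: geq_minl | apply: leq_trans; exact: geq_minr].
elim/big_ind: _ => [|x y kx ky|i _]; last exact: kz.
  (* The default value [n] of the minimum is also above [k], as it bounds the count of any index;
     [0 < n] provides one. *)
  apply: (lt_le_trans (kz (Ordinal n0))); rewrite ler_nat.
  by rewrite -[leqRHS]card_ord max_card.
by rewrite /minn; case: ifP.
Qed.

Lemma Inv_crossing (n : nat) (z : 'I_n -> R * R) (i j : 'I_n) :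
  (j \in Defs.Inv z i) =
  (z j \in crossing (z i).1 (z i).2 (z i).1 (z i).2).
Proof.
apply/idP/idP; rewrite !inE /crossing /= => h.
  have [h1|h1|h1] := ltgtP ((z i).1 - (z j).1) 0.
  - by right; move: h; rewrite nmulr_rlt0// => ?; split; lra.
  - by left; move: h; rewrite pmulr_rlt0// => ?; split; lra.
  - by move: h; rewrite h1 mul0r ltxx.
case: h => -[? ?].
  by rewrite pmulr_rlt0; lra.
by rewrite nmulr_rlt0; lra.
Qed.

Lemma grid_cell (n : nat) (x : R) : (0 < n)%N -> 0 <= x <= 1 ->
  exists k : 'I_n, k%:R * isqrt n ^+ 2 <= x <= k%:R * isqrt n ^+ 2 + isqrt n ^+ 2.
Proof.
case: n => // n _ /andP[x0 x1]; have n0 : 0 < n.+1%:R :> R by rewrite ltr0n.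
have xn0 : 0 <= x * n.+1%:R by rewrite mulr_ge0// ltW.
have cell (k : nat) : (k%:R * isqrt n.+1 ^+ 2 <= x <=
    k%:R * isqrt n.+1 ^+ 2 + isqrt n.+1 ^+ 2) =
    (k%:R <= x * n.+1%:R <= k.+1%:R).
  rewrite isqrt_sqr ler_pdivrMr//.
  by rewrite -[X in _ * X + X]mul1r mulrA -mulrDl mulr1 natr1 ler_pdivlMr.
have /andP[xl xr] := truncn_itv xn0.
(* There are [n.+1] cells; the truncation exceeds [n] only at [x = 1], which belongs to the last
   cell since cells are closed. *)
have [le_n|lt_n] := leqP (Num.truncn (x * n.+1%:R)) n.
  by exists (Ordinal (le_n : (_ < n.+1)%N)); rewrite cell/= xl ltW.
exists ord_max; rewrite cell/=; apply/andP; split.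
  by apply: le_trans xl; rewrite ler_nat ltnW.
by rewrite ler_piMl// ltW.
Qed.

Lemma grid_itv (n : nat) (k : 'I_n) : (0 < n)%N ->
  0 <= k%:R * isqrt n ^+ 2 :> R /\
  k%:R * isqrt n ^+ 2 + isqrt n ^+ 2 <= 1 :> R.
Proof.
move=> n0; rewrite isqrt_sqr; split; first by rewrite mulr_ge0// invr_ge0.
rewrite -[X in _ + X]mul1r -mulrDl natr1 ler_pdivrMr ?ltr0n// mul1r ler_nat.
exact: ltn_ord.
Qed.

End minimal_inversion_theory.

(** * The survival function of the minimal inversion *)

Section survival.
Context {R : realType} {mu : probability (R * R)%type R}
  (mu_permuton : is_permuton mu) {n : nat} {d : measure_display}
  {W : measurableType d} {P : probability W R}
  (Z : 'I_n -> {RV P >-> (R * R)%type}) (Z_iid : iid mu Z) (n_gt0 : (0 < n)%N).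

Definition survival (t : R) : set W :=
  [set w | t < scaled_minimal_inversion Z w].

Lemma measurable_survival (t : R) : measurable (survival t).
Proof.
have -> : survival t = (scaled_minimal_inversion Z : {RV P >-> R}) @^-1` `]t, +oo[.
  by apply/seteqP; split => w /=; rewrite in_itv/= andbT.
by rewrite -[X in measurable X]setTI; exact: measurable_funPT.
Qed.

Lemma survivalP (t : R) (w : W) : survival t w <->
  forall i, t / isqrt n < #|Defs.Inv (Z ^~ w) i|%:R.
Proof.
rewrite -ltr_minimal_inversion//.
by rewrite /survival /= ltr_pdivrMr ?isqrt_gt0// mulrC.
Qed.

Let x (k : 'I_n) : R := k%:R * isqrt n ^+ 2.
Let y (k : 'I_n) : R := k%:R * isqrt n ^+ 2 + isqrt n ^+ 2.

(** The region inverted with a random point is itself random. For a point in cell [c] it lies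
    between the deterministic sets [inner c] and [outer c], to which the tail bounds apply. *)
Let inner (c : 'I_n * 'I_n) := crossing (x c.1) (x c.2) (y c.1) (y c.2).
Let outer (c : 'I_n * 'I_n) := crossing (y c.1) (y c.2) (x c.1) (x c.2).

Let cells := enum {: 'I_n * 'I_n}.

Let size_cells : size cells = (n * n)%N.
Proof. by rewrite -cardE card_prod card_ord. Qed.

Let inner_Inv c i w : x c.1 <= (Z i w).1 <= y c.1 -> x c.2 <= (Z i w).2 <= y c.2 ->
  (#|hits Z (inner c) w| <= #|Defs.Inv (Z ^~ w) i|)%N.
Proof.
move=> /andP[? ?] /andP[? ?]; apply/subset_leq_card/fintype.subsetP => j.
by rewrite Inv_crossing !inE; exact: crossing_subset.
Qed.

Let Inv_outer c i w : x c.1 <= (Z i w).1 <= y c.1 -> x c.2 <= (Z i w).2 <= y c.2 ->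
  (#|Defs.Inv (Z ^~ w) i| <= #|hits Z (outer c) w|)%N.
Proof.
move=> /andP[? ?] /andP[? ?]; apply/subset_leq_card/fintype.subsetP => j.
by rewrite Inv_crossing !inE; exact: crossing_subset.
Qed.

Let bigcup_cells (B : 'I_n * 'I_n -> set W) c :
  B c `<=` \big[setU/set0]_(c <- cells) B c.
Proof.
move=> w Bcw; rewrite -bigcup_seq; exists c => //=.
by rewrite mem_enum.
Qed.

(** If all points avoid the triangles and no cell shows an exceptionally small count, every point
    has more than [t / isqrt n] inversions. *)
Lemma survival_ge (t s s' e : R) : 0 <= e ->
  (forall u v z, 0 <= u -> u + isqrt n ^+ 2 <= 1 ->
    0 <= v -> v + isqrt n ^+ 2 <= 1 ->
    u <= z.1 <= u + isqrt n ^+ 2 -> v <= z.2 <= v + isqrt n ^+ 2 ->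
    ~ corners (s * isqrt n) z ->
    s' * isqrt n <= pr mu (crossing u v (u + isqrt n ^+ 2) (v + isqrt n ^+ 2))) ->
  (forall A, measurable A -> s' * isqrt n <= pr mu A ->
    pr P [set w | #|hits Z A w|%:R <= t / isqrt n] <= e) ->
  (1 - pr mu (corners (s * isqrt n))) ^+ n - (n * n)%:R * e <=
  pr P (survival t).
Proof.
move=> e0 off tail.
have mC := measurable_corners (s * isqrt n); have mU := @measurable_unit_square R.
(* A cell whose inner set is too light gets the empty event: by [off], it contains no point outside
   the triangles. *)
pose B c : set W := if s' * isqrt n <= pr mu (inner c)
  then [set w | #|hits Z (inner c) w|%:R <= t / isqrt n] else set0.
have mB c : measurable (B c).
  rewrite /B; case: ifP => // _; apply: (measurable_hits _ _
    (fun J => #|J|%:R <= t / isqrt n)); exact: measurable_crossing.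
have Be c : pr P (B c) <= e.
  rewrite /B; case: ifP => h; last by rewrite /pr measure0.
  by apply: tail h; exact: measurable_crossing.
(* Restricting to the unit square costs no mass and places every point in a cell. *)
have mG : measurable (~` corners (s * isqrt n) `&` unit_square).
  by apply: measurableI => //; exact: measurableC.
have [mE prE'] := pr_all_in Z Z_iid _ mG.
rewrite -pr_setC// -(pr_unit_square mu_permuton _ (measurableC mC)) -prE'.
rewrite lerBlDr -size_cells.
apply: le_trans (lerD (lexx _) (pr_bigsetU_le P _ cells B e mB Be)).
apply: le_trans (prU_le _ _ _ (measurable_survival t) (bigsetU_measurable _ _)) => //.
apply: le_pr => //.
  by apply: measurableU; [exact: measurable_survival | exact: bigsetU_measurable].
move=> w /= Gw; have [Bw|nBw] := pselect ((\big[setU/set0]_(c <- cells) B c) w).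
  by right.
left; apply/survivalP => i; have [nCi /unit_squareE[x0 x1 y0 y1]] := Gw i.
have [k xk] : exists k, x k <= (Z i w).1 <= y k by apply: grid_cell => //; rewrite x0.
have [l yl] : exists l, x l <= (Z i w).2 <= y l by apply: grid_cell => //; rewrite y0.
have [xk0 yk1] := @grid_itv R n k n_gt0; have [xl0 yl1] := @grid_itv R n l n_gt0.
have p_ge : s' * isqrt n <= pr mu (inner (k, l)) by exact: off nCi.
apply: (@lt_le_trans _ _ #|hits Z (inner (k, l)) w|%:R); last first.
  by rewrite ler_nat; exact: inner_Inv.
rewrite ltNge; apply/negP => h; apply: nBw.
by apply: (bigcup_cells B (k, l)); rewrite /B p_ge.
Qed.

(** Conversely, a point in a triangle lies in a cell with a light outer set; survival forces a large
    count there, which is exceptional. The bound on [s * isqrt n] keeps the triangles inside the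
    unit square, hence on the grid. *)
Lemma survival_le (t s s' e : R) : 0 <= e -> s * isqrt n <= 1 ->
  (forall u v z, 0 <= u -> u + isqrt n ^+ 2 <= 1 ->
    0 <= v -> v + isqrt n ^+ 2 <= 1 ->
    u <= z.1 <= u + isqrt n ^+ 2 -> v <= z.2 <= v + isqrt n ^+ 2 ->
    corners (s * isqrt n) z ->
    pr mu (crossing (u + isqrt n ^+ 2) (v + isqrt n ^+ 2) u v) <= s' * isqrt n) ->
  (forall A, measurable A -> pr mu A <= s' * isqrt n ->
    pr P [set w | t / isqrt n <= #|hits Z A w|%:R] <= e) ->
  pr P (survival t) <=
  (1 - pr mu (corners (s * isqrt n))) ^+ n + (n * n)%:R * e.
Proof.
move=> e0 s1 on tail; have mC := measurable_corners (s * isqrt n).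
pose B c : set W := if pr mu (outer c) <= s' * isqrt n
  then [set w | t / isqrt n <= #|hits Z (outer c) w|%:R] else set0.
have mB c : measurable (B c).
  rewrite /B; case: ifP => // _; apply: (measurable_hits _ _
    (fun J => t / isqrt n <= #|J|%:R)); exact: measurable_crossing.
have Be c : pr P (B c) <= e.
  rewrite /B; case: ifP => h; last by rewrite /pr measure0.
  by apply: tail h; exact: measurable_crossing.
have [mE prE'] := pr_all_in Z Z_iid _ (measurableC mC).
rewrite -pr_setC// -prE' -size_cells.
apply: le_trans (lerD (lexx _) (pr_bigsetU_le P _ cells B e mB Be)).
apply: le_trans (prU_le _ _ _ mE (bigsetU_measurable _ _)) => //.
apply: le_pr => //; first exact: measurable_survival.
  by apply: measurableU => //; exact: bigsetU_measurable.
move=> w /survivalP Sw.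
have [Bw|nBw] := pselect ((\big[setU/set0]_(c <- cells) B c) w); first by right.
left => i Ci.
have /unit_squareE[x0 x1 y0 y1] : unit_square (Z i w).
  by case: Ci; [exact: triangle00_subset | exact: triangle11_subset].
have [k xk] : exists k, x k <= (Z i w).1 <= y k by apply: grid_cell => //; rewrite x0.
have [l yl] : exists l, x l <= (Z i w).2 <= y l by apply: grid_cell => //; rewrite y0.
have [xk0 yk1] := @grid_itv R n k n_gt0; have [xl0 yl1] := @grid_itv R n l n_gt0.
have p_le : pr mu (outer (k, l)) <= s' * isqrt n by exact: on Ci.
apply: nBw; apply: (bigcup_cells B (k, l)); rewrite /B p_le /=.
apply: (le_trans (ltW (Sw i))); rewrite ler_nat; exact: Inv_outer.
Qed.

End survival.

(** * Limit of the survival function *)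

Section survival_limit.
Context {R : realType} {mu : probability (R * R)%type R} {f : R * R -> R}.
Hypothesis mu_permuton : is_permuton mu.
Hypothesis f_density : is_density mu f.
Hypothesis f_pos : forall p, unit_square p -> 0 < f p.
Hypothesis f_cont0 : square_continuous_at f (0, 0).
Hypothesis f_cont1 : square_continuous_at f (1, 1).

Let b : R := (f (0, 0) + f (1, 1)) / 2.

(** By [pr_corners], [n] times the mass of the triangles tends to [b * s ^+ 2]; the tolerance
    [e / s ^+ 2] there becomes [e] after rescaling. *)
Lemma cvg_corners_avoidance (s : R) : 0 < s ->
  (1 - pr mu (corners (s * isqrt n))) ^+ n @[n --> \oo] -->
  expR (- (b * s ^+ 2)).
Proof.
move=> s0; apply: cvg_expr_1B => [n|]; first exact: pr_ge0.
apply/cvgrPdist_le => e e0; have es0 : 0 < e / s ^+ 2.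
  by rewrite divr_gt0// exprn_gt0.
have [r0 r00 Hr] := pr_corners _ _ f_density f_pos f_cont0 f_cont1 _ es0.
have rs0 : 0 < r0 / s by rewrite divr_gt0.
near=> n; have [n0 ir] : (0 < n)%N /\ isqrt n <= r0 / s.
  by near: n; exact: isqrt_near_le.
have i0 : 0 < isqrt n :> R := isqrt_gt0 n n0.
have n0' : 0 < n%:R :> R by rewrite ltr0n.
have sr : s * isqrt n <= r0 by rewrite mulrC -ler_pdivlMr.
have := Hr _ (mulr_gt0 s0 i0) sr; rewrite exprMn isqrt_sqr -(ler_pM2l n0').
have -> : n%:R * (e / s ^+ 2 * (s ^+ 2 / n%:R)) = e.
  by field; rewrite !gt_eqF.
apply: le_trans; rewrite distrC -[X in X * `|_|]gtr0_norm// -normrM mulrBr.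
rewrite le_eqVlt; apply/orP; left; apply/eqP; congr `|_ - _|.
by rewrite /b; field; rewrite gt_eqF.
Unshelve. all: by end_near. Qed.

Variables (d : nat -> measure_display) (Omega : forall n, measurableType (d n))
  (P : forall n, probability (Omega n) R)
  (Z : forall n, 'I_n -> {RV (P n) >-> (R * R)%type}).
Hypothesis Z_iid : forall n, iid mu (Z n).

Let g (s : R) : R := expR (- (b * s ^+ 2)).

Let g_continuous : continuous g.
Proof.
move=> s; apply: continuous_cvg; first exact: continuous_expR.
apply: cvgN; apply: cvgM; first exact: cvg_cst.
exact: exprn_continuous.
Qed.

Let survival_near_ge (t s e : R) : 0 <= t -> t < s -> 0 < e ->
  \forall n \near \oo, g s - e <= pr (P n) (survival (Z n) t).
Proof.
(* The midpoint leaves room on both sides: [s' < s] for the grid approximation and [t < s'] for the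
   concentration. *)
move=> t0 ts e0; pose s' := (t + s) / 2.
have ts' : t < s' by rewrite /s'; lra.
have [k k0 tail] := @lower_tail _ _ _ mu t s' t0 ts'.
have s'0 : 0 <= s' by lra.
have s's : s' < s by rewrite /s'; lra.
have [i0 i00 off] :=
  pr_crossing_off_corners _ _ mu_permuton f_density f_pos f_cont0 f_cont1 _ _ s'0 s's.
have s0 : 0 < s by lra.
have e20 : 0 < e / 2 by lra.
near=> n; have [n0 ii] : (0 < n)%N /\ isqrt n <= i0.
  by near: n; exact: isqrt_near_le.
have in0 : 0 < isqrt n :> R := isqrt_gt0 n n0.
have V : `|g s - (1 - pr mu (corners (s * isqrt n))) ^+ n| <= e / 2.
  by near: n; move/cvgrPdist_le : (cvg_corners_avoidance _ s0); apply.
have E : `|0 - (n * n)%:R * expR (- (k / isqrt n))| <= e / 2.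
  by near: n; move/cvgrPdist_le : (cvg_sqr_expRN_sqrt _ k0); apply.
apply: le_trans (survival_ge mu_permuton (Z n) (Z_iid n) n0 t s s'
  (expR (- (k / isqrt n))) (expR_ge0 _) _ _); first last.
- by move=> A mA Ap; exact: tail.
- by move=> u v z *; exact: (off _ _ _ z).
move: V E; rewrite !ler_norml => /andP[_ V] /andP[E _]; lra.
Unshelve. all: by end_near. Qed.

Let survival_near_le (t s e : R) : 0 < s -> s < t -> 0 < e ->
  \forall n \near \oo, pr (P n) (survival (Z n) t) <= g s + e.
Proof.
move=> s0 st e0; pose s' := (t + s) / 2.
have s't : s' < t by rewrite /s'; lra.
have s'0 : 0 <= s' by rewrite /s'; lra.
have [k k0 tail] := @upper_tail _ _ _ mu s' t s'0 s't.
have ss' : s < s' by rewrite /s'; lra.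
have [i0 i00 on] := pr_crossing_on_corners _ mu_permuton _ _ ss'.
have e20 : 0 < e / 2 by lra.
have si0 : 0 < s^-1 by rewrite invr_gt0.
near=> n; have [n0 ii] : (0 < n)%N /\ isqrt n <= i0.
  by near: n; exact: isqrt_near_le.
have [_ is1] : (0 < n)%N /\ isqrt n <= s^-1.
  by near: n; exact: isqrt_near_le.
have in0 : 0 < isqrt n :> R := isqrt_gt0 n n0.
have V : `|g s - (1 - pr mu (corners (s * isqrt n))) ^+ n| <= e / 2.
  by near: n; move/cvgrPdist_le : (cvg_corners_avoidance _ s0); apply.
have E : `|0 - (n * n)%:R * expR (- (k / isqrt n))| <= e / 2.
  by near: n; move/cvgrPdist_le : (cvg_sqr_expRN_sqrt _ k0); apply.
apply: le_trans (survival_le (Z n) (Z_iid n) n0 t s s'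
  (expR (- (k / isqrt n))) (expR_ge0 _) _ _ _) _.
- by rewrite -ler_pdivlMl// mulr1.
- by move=> u v z *; exact: (on _ _ _ z).
- by move=> A mA Ap; exact: tail.
move: V E; rewrite !ler_norml => /andP[V _] /andP[E _]; lra.
Unshelve. all: by end_near. Qed.

(** The two bounds hold for each [s] strictly above, respectively below, [t]; continuity of [g]
    closes the gap. *)
Lemma cvg_survival (t : R) : 0 <= t ->
  pr (P n) (survival (Z n) t) @[n --> \oo] --> expR (- (b * t ^+ 2)).
Proof.
move=> t0; apply/cvgrPdist_le => e e0; have e20 : 0 < e / 2 by lra.
have /cvgrPdist_le/(_ _ e20)/nbhs_ballP[r /= r0 gr] := g_continuous t.
have lower : \forall n \near \oo, g t - e <= pr (P n) (survival (Z n) t).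
  have tr : t < t + r / 2 by lra.
  have := survival_near_ge _ _ _ t0 tr e20; apply: filterS => n; apply: le_trans.
  have := gr (t + r / 2); rewrite /ball/= ler_norml ltr_norml.
  have -> : t - (t + r / 2) = - (r / 2) by lra.
  by move=> /(_ _)/andP[]; [apply/andP; split; lra | lra].
have upper : \forall n \near \oo, pr (P n) (survival (Z n) t) <= g t + e.
  (* At [t = 0] no positive [s] lies below [t], but the limit is 1, a trivial upper bound. *)
  move: t0; rewrite le_eqVlt => /orP[/eqP t0|t0].
    apply: nearW => n; apply: le_trans (pr_le1 _ _ (measurable_survival _ _)) _.
    by rewrite /g -t0 expr0n mulr0 oppr0 expR0 lerDl ltW.
  (* Positive, below [t], and within [r] of it. *)
  pose s := Num.max (t / 2) (t - r / 2).
  have s0 : 0 < s by rewrite lt_max; apply/orP; left; lra.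
  have st : s < t by rewrite gt_max; apply/andP; split; lra.
  have sr : t - r / 2 <= s by rewrite le_max lexx orbT.
  have := survival_near_le _ _ _ s0 st e20; apply: filterS => n /le_trans; apply.
  have := gr s; rewrite /ball/= ler_norml ltr_norml.
  by move=> /(_ _)/andP[]; [apply/andP; split; lra | lra].
near=> n; rewrite ler_distlC -/(g t); apply/andP; split.
  by near: n.
by near: n.
Unshelve. all: by end_near. Qed.

End survival_limit.

(** * Convergence in distribution *)

Theorem corollary1p2 (R : realType) (mu : probability (R * R)%type R)
  (f : R * R -> R)
  (mu_permuton : is_permuton mu)
  (f_density : is_density mu f)
  (f_piecewise : piecewise_continuous f)
  (f_pos : forall p, unit_square p -> 0 < f p)
  (f_cont0 : square_continuous_at f (0, 0))
  (f_cont1 : square_continuous_at f (1, 1))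
  (d : nat -> measure_display) (Omega : forall n, measurableType (d n))
  (P : forall n, probability (Omega n) R)
  (Z : forall n, 'I_n -> {RV (P n) >-> (R * R)%type})
  (Z_iid : forall n, iid mu (Z n))
  (nu : probability R R)
  (nu_rayleigh : is_rayleigh 2 ((f (0, 0) + f (1, 1)) / 2) nu) :
  converges_in_distribution
    (fun n => scaled_minimal_inversion (Z n) : {RV (P n) >-> R}) nu.
Proof.
move=> t _; have [nu0 nut] := nu_rayleigh.
(* For negative [t] both distribution functions vanish; otherwise they are the complements of the
   survival functions. *)
have [t0|t0] := ltP t 0.
  have -> : nu `]-oo, t]%classic = 0%E.
    apply/eqP; rewrite -measure_le0.
    have -> : 0%E = nu (~` `[0, +oo[%classic).
      by rewrite probability_setC// nu0 subee.
    apply: le_measure; rewrite ?inE//; first exact: measurableC.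
    by move=> x /=; rewrite !in_itv/= andbT => xt; apply/negP; rewrite -ltNge; lra.
  rewrite (_ : (fun n => _) = cst 0%E); first exact: cvg_cst.
  apply/funext => n; rewrite /cdf /distribution /pushforward.
  rewrite (_ : _ @^-1` _ = set0) ?measure0//.
  rewrite -subset0 => w /=; rewrite in_itv/= /scaled_minimal_inversion.
  by apply/negP; rewrite -ltNge (lt_le_trans t0)// mulr_ge0// invr_ge0 sqrtr_ge0.
have -> : nu `]-oo, t]%classic =
    (1 - expR (- ((f (0, 0) + f (1, 1)) / 2 * t ^+ 2)))%:E.
  by rewrite -setCitvr probability_setC// nut// powR_mulrn// mulNr EFinB.
rewrite (_ : (fun n => _) = (fun n => (1 - pr (P n) (survival (Z n) t))%:E)).
  apply: cvg_EFin; first by apply: nearW.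
  apply: cvgB; first exact: cvg_cst.
  exact: (cvg_survival mu_permuton f_density f_pos f_cont0 f_cont1 _ _ _ _ Z_iid).
apply/funext => n; rewrite -pr_setC; last exact: measurable_survival.
rewrite -prE; last by apply: measurableC; exact: measurable_survival.
rewrite /cdf /distribution /pushforward; congr (P n _).
by apply/seteqP; split => w /=; rewrite in_itv/= leNgt => /negP.
Qed.
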